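(* For every integer $n\ge 7$ we have \[ \mathrm{ex}(n,\mathscr{F}) = b(n) = \frac{n-2}{2}\cdot\left\lfloor \frac{n^2}{4}\right\rfloor, \] where $\mathscr{F}$ denotes the Fano plane. Moreover, for $n\ge 8$ the only extremal hypergraph (i.e. the only $3$-uniform hypergraph on $n$ vertices with $b(n)$ edges not containing $\mathscr{F}$, up to isomorphism) is the balanced, complete, bipartite hypergraph $B_n$, while for $n=7$ there are exactly two extremal hypergraphs, namely $B_7$ and $J_7$.
   Context: All hypergraphs are $3$-uniform: a hypergraph $H=(V,E)$ has a vertex set $V$ and an edge set $E\subseteq\{e\subseteq V: |e|=3\}$. $H$ contains $F$ if $H$ has a (not necessarily induced) subhypergraph isomorphic to $F$. For a hypergraph $F$, $\mathrm{ex}(n,F)$ is the maximum number of edges of a hypergraph on $n$ vertices not containing $F$. The Fano plane $\mathscr{F}$ is the hypergraph on $7$ vertices (the points of the projective plane over the field with two elements) whose $7$ edges are its lines; equivalently, with vertex set $\{1,\dots,7\}$ and edges $123,345,156,147,367,257,246$. $B_n$ is the hypergraph on $n$ vertices with a partition $V=X\cup Y$, $X\cap Y=\emptyset$, $||X|-|Y||\le 1$, whose edges are exactly the triples meeting both $X$ and $Y$; it has $b(n)=\binom{n}{3}-\binom{\lfloor n/2\rfloor}{3}-\binom{\lfloor (n+1)/2\rfloor}{3}$ edges. $J_7$ is the hypergraph obtained from the complete $3$-uniform hypergraph on $7$ vertices by deleting the five edges containing a fixed pair of vertices. *)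

(* Defs.v *)
From mathcomp Require Import all_boot all_order all_algebra all_fingroup.
Set Implicit Arguments. Unset Strict Implicit. Unset Printing Implicit Defensive.

Definition uniform3 (n : nat) (E : {set {set 'I_n}}) : bool :=
  [forall e in E, #|e| == 3].

Definition contains (m n : nat) (F : {set {set 'I_m}}) (E : {set {set 'I_n}}) : bool :=
  [exists f : {ffun 'I_m -> 'I_n},
     injectiveb f && [forall e in F, (f @: e) \in E]].

Definition ex (m n : nat) (F : {set {set 'I_m}}) : nat :=
  \max_(E : {set {set 'I_n}} | uniform3 E && ~~ contains F E) #|E|.

Definition iso (n : nat) (E1 E2 : {set {set 'I_n}}) : Prop :=
  exists s : {perm 'I_n}, [set ((s : 'I_n -> 'I_n) @: e) | e : {set 'I_n} in E1] = E2.

(* Fano plane with vertices 1..7 renamed 0..6: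
   123,345,156,147,367,257,246. *)
Definition tri (n : nat) (a b c : nat) : {set 'I_n.+1} :=
  [set inord a; inord b; inord c].

Definition fano : {set {set 'I_7}} :=
  [set tri 6 0 1 2; tri 6 2 3 4; tri 6 0 4 5; tri 6 0 3 6;
       tri 6 2 5 6; tri 6 1 4 6; tri 6 1 3 5].

Definition b (n : nat) : nat := 'C(n, 3) - 'C(n./2, 3) - 'C(n.+1./2, 3).

Definition Bn (n : nat) : {set {set 'I_n}} :=
  [set e : {set 'I_n} | (#|e| == 3)
     && [exists x in e, x < n./2] && [exists y in e, n./2 <= y]].

Definition J7 : {set {set 'I_7}} :=
  [set e : {set 'I_7} | (#|e| == 3) && ~~ ((inord 0 \in e) && (inord 1 \in e))].

(* Main.v *)
(* Fano-free means that for an edge pqr no four further points carry three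
   distinct perfect matchings lying in the links of p, q and r respectively.

   Seven points: each triple lies in 6 of the 30 Fano planes on seven points, so
   at least five triples are missing; if exactly five are, then any two of them
   meet in 0 or 2 points, which leaves J_7 and B_7.

   Upper bound, n >= 8, by induction. Remove a tetrahedron S = K_4 and let m = n - 4.
   The four links of S give weights 0..4 to the pairs outside S; by Hall's theorem,
   in every 4-set some matching has weight at most 4 or the total is at most 18, and
   this bounds the total weight by 3 binom(m,2) + floor(m/2). If there is no K_5, an
   outside point forms an edge with at most 5 pairs of S, and summing up gives
   exactly b(n) - b(n - 4). A hypergraph without K_4 is too sparse by averaging over
   4-sets. If there is a K_5 or K_6, remove it instead: its links are averages of
   links of tetrahedra, and the bounds on seven points restrict the pairs inside the
   clique, so that the number of edges is strictly smaller than b(n).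

   Equality, n >= 8: take a tetrahedron S. All estimates are tight, which forces the
   outside pairs to have weight 4 across and 2 inside a bipartition X, Y; then the
   colours inside X and inside Y are complementary pairs of points of S, and adding
   these pairs to the two classes yields a bipartition of all vertices with no edge
   inside a class. *)

Require Import Defs.
From mathcomp Require Import all_boot all_order all_algebra all_fingroup zify.
Import GRing.Theory Num.Theory.
Set Implicit Arguments. Unset Strict Implicit. Unset Printing Implicit Defensive.

(** Clears quantified hypotheses and boolean facts other than comparisons of naturals, so that [lia]
    sees only what it can use. *)
Ltac slia :=
  repeat match goal with
  | H : is_true ?b |- _ =>
    lazymatch b with
    | leq _ _ => fail
    | ~~ (@eq_op _ ?a _) =>
      lazymatch type of a with nat => fail | _ => clear H end
    | _ => clear H
    end
  | H : forall _, _ |- _ => clear H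
  end; lia.

(** * Weighted graphs *)

Lemma split_set (V : finType) (x : V) (U : {set V}) : x \in U ->
  exists T : {set V}, [/\ U = x |: T, x \notin T, #|U| = #|T|.+1 &
    forall y, y \in U -> y != x -> y \in T].
Proof.
move=> xU; exists (U :\ x); split; first by rewrite setD1K.
- by rewrite setD11.
- by rewrite (cardsD1 x U) xU.
- by move=> y yU yx; rewrite !inE yx.
Qed.

Lemma sum_le_const (V : finType) (T : {set V}) (f : V -> nat) c :
  (forall x, x \in T -> f x <= c) -> \sum_(x in T) f x <= c * #|T|.
Proof. by move=> fc; rewrite mulnC -sum_nat_const; exact: leq_sum. Qed.

Lemma sum_eq_const (V : finType) (T : {set V}) (f : V -> nat) c :
  (forall x, x \in T -> f x <= c) -> c * #|T| <= \sum_(x in T) f x ->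
  forall x, x \in T -> f x = c.
Proof.
move=> fc; rewrite mulnC -sum_nat_const => le_c x xT.
apply/eqP; rewrite eqn_leq fc //=; move: le_c.
rewrite (bigD1 x) //= [X in _ <= X](bigD1 x) //=.
have : \sum_(i in T | i != x) f i <= \sum_(i in T | i != x) c.
  by apply: leq_sum => i /andP[iT _]; exact: fc.
lia.
Qed.

(* [a + r], [b + q], [c + p] are the weights of the three perfect matchings. *)
Lemma four_set_le a b c p q r : a <= 4 -> b <= 4 -> c <= 4 ->
  p <= 4 -> q <= 4 -> r <= 4 ->
  [|| a + r <= 4, b + q <= 4, p + c <= 4 | a + r + (b + q) + (p + c) <= 18] ->
  a + b + c + (p + q + r) <= 20.
Proof. by move=> ? ? ? ? ? ? /or4P[] ?; lia. Qed.

(** The total is 20, so some matching has weight at most 4. If it contained an edge of weight 4,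
    then [p] or [q] would vanish and the other two would reach at most 8; so it is the matching with
    [a]. *)
Lemma four_set_eq a b c p q r : a = 3 -> b = 4 -> c = 4 ->
  p <= 4 -> q <= 4 -> r <= 4 ->
  [|| a + r <= 4, b + q <= 4, p + c <= 4 | a + r + (b + q) + (p + c) <= 18] ->
  p + q + r = 9 -> r = 1.
Proof. by move=> -> -> -> ? ? ? /or4P[] ?; lia. Qed.

Section Weights.
Variables (V : finType) (w : V -> V -> nat).
Hypothesis wC : forall x y, w x y = w y x.
Hypothesis wxx : forall x, w x x = 0.
Implicit Types (x y z : V) (U T : {set V}).

Definition wdeg x (U : {set V}) := \sum_(y in U) w x y.
(** Ordered pairs are summed, so every pair counts twice; most factors 2 below come from this. *)
Definition wsum (U : {set V}) := \sum_(x in U) wdeg x U.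

Lemma wdeg_set0 x : wdeg x set0 = 0.
Proof. by rewrite /wdeg big_set0. Qed.

Lemma wsum_set0 : wsum set0 = 0.
Proof. by rewrite /wsum big_set0. Qed.

Lemma wdegU1 x y U : y \notin U -> wdeg x (y |: U) = w x y + wdeg x U.
Proof. by move=> yU; rewrite /wdeg big_setU1. Qed.

Lemma wsumU1 x U : x \notin U -> wsum (x |: U) = wsum U + 2 * wdeg x U.
Proof.
move=> xU; rewrite /wsum big_setU1 //= wdegU1 // wxx.
under eq_bigr => y _ do rewrite wdegU1 // wC.
by rewrite big_split /= -/(wdeg x U); lia.
Qed.

Lemma wsum_le c U : (forall x y, x \in U -> y \in U -> w x y <= c) ->
  wsum U <= c * (#|U| * #|U|.-1).
Proof.
move=> wc; have -> : c * (#|U| * #|U|.-1) = c * #|U|.-1 * #|U| by lia.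
apply: sum_le_const => x xU; case: (split_set xU) => T [eU xT -> _].
rewrite eU wdegU1 // wxx; apply: sum_le_const => y yT.
by apply: wc; rewrite // eU inE yT orbT.
Qed.

(* Twice the weight of a balanced bipartition with weight 4 across and 2 inside. *)
Definition wmax m := 3 * (m * m.-1) + 2 * m./2.

Lemma wmaxE m : wmax m + 3 * m = 3 * (m * m) + 2 * m./2.
Proof. by rewrite /wmax; case: m => [|m] //=; lia. Qed.

Hypothesis w4 : forall x y, w x y <= 4.

Lemma wsum_triple U : #|U| = 3 -> exists x y z,
  [/\ x \in U, y \in U, z \in U, [/\ x != y, x != z & y != z] & wsum U = 2 * (w x y + w x z + w y z)].
Proof.
move=> U3; have [x xU] : exists x, x \in U by apply/set0Pn; rewrite -card_gt0 U3.
case: (split_set xU) => T [eU xT]; rewrite U3 => -[T2] _.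
have [y yT] : exists y, y \in T by apply/set0Pn; rewrite -card_gt0 -T2.
case: (split_set yT) => T' [eT yT']; rewrite -T2 => -[T'1] _.
have [z eT'] : exists z, T' = [set z] by apply/cards1P/eqP.
move: xT; rewrite eU eT eT' -(setU0 [set z]) !inE !negb_or => /and3P[xy xz _].
move: yT'; rewrite eT' inE => yz.
exists x, y, z; split=> //; rewrite ?inE ?eqxx ?orbT //.
have xN : x \notin y |: (z |: set0) by rewrite !inE (negPf xy) (negPf xz).
have yN : y \notin z |: set0 by rewrite !inE (negPf yz).
have zN : z \notin set0 by rewrite inE.
by rewrite !wsumU1 // !wdegU1 // !wdeg_set0 wsum_set0; lia.
Qed.

Lemma wsum_pair U x y : x \in U -> y \in U -> x != y ->
  exists T, [/\ #|U| = #|T|.+2, T \subset U, U = x |: (y |: T),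
    x \notin T /\ y \notin T &
    wsum U = 2 * w x y + 2 * (\sum_(z in T) (w x z + w y z)) + wsum T].
Proof.
move=> xU yU xy; case: (split_set xU) => T [eU xT -> sU].
have yT : y \in T by apply: sU; rewrite // eq_sym.
case: (split_set yT) => T' [eT yT' -> sT].
exists T'; split=> //.
- by rewrite eU eT; apply/subsetP => z zT; rewrite !inE zT !orbT.
- by rewrite eU eT.
- by move: xT; rewrite eT !inE negb_or => /andP[].
rewrite eU eT wsumU1 -?eT // eT wsumU1 // wdegU1 // big_split /= -/(wdeg x T') -/(wdeg y T').
by move: (wsum T') (wdeg x T') (wdeg y T') (w x y); clear=> *; lia.
Qed.

Hypothesis wQ : forall u v x y,
  [|| w u v + w x y <= 4, w u x + w v y <= 4, w u y + w v x <= 4 |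
      (w u v + w x y) + (w u x + w v y) + (w u y + w v x) <= 18].

Definition heavy (U : {set V}) :=
  [exists x in U, exists y in U, exists z in U,
    [&& x != y, x != z, y != z & 11 <= w x y + w x z + w y z]].

Lemma heavyN U x y z : ~~ heavy U -> x \in U -> y \in U -> z \in U ->
  w x y + w x z + w y z <= 10.
Proof.
move=> hU xU yU zU.
case: (eqVneq x y) => [->|xy]; first by rewrite wxx; move: (w4 y z); lia.
case: (eqVneq x z) => [->|xz]; first by rewrite wxx (wC y z); move: (w4 z y); lia.
case: (eqVneq y z) => [->|yz]; first by rewrite wxx; move: (w4 x z); lia.
rewrite leqNgt; apply: contra hU => h.
apply/existsP; exists x; rewrite xU; apply/existsP; exists y; rewrite yU.
by apply/existsP; exists z; rewrite zU xy xz yz.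
Qed.

Lemma heavyS U T : T \subset U -> ~~ heavy U -> ~~ heavy T.
Proof.
move=> TU; apply: contra => /existsP[x /andP[xT /existsP[y /andP[yT /existsP[z /andP[zT h]]]]]].
apply/existsP; exists x; rewrite (subsetP TU) //.
apply/existsP; exists y; rewrite (subsetP TU) //.
by apply/existsP; exists z; rewrite (subsetP TU).
Qed.

(** A pair of weight 4 sends at most 6 to any third vertex, and removing it costs no more than
    [wmax] grows over two vertices. Without such a pair all weights are at most 3. *)
Lemma wsum_light m U : #|U| <= m -> ~~ heavy U -> wsum U <= wmax #|U|.
Proof.
elim: m U => [|m IH] U Um hU.
  have -> : U = set0 by apply/cards0_eq; lia.
  by rewrite wsum_set0.
case: (boolP [exists x in U, exists y in U, 3 < w x y]); last first.
  rewrite negb_exists => /forallP h; apply: leq_trans (@wsum_le 3 U _) _; last by rewrite /wmax; lia.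
  move=> x y xU yU; rewrite leqNgt; apply/negP => xy.
  by move: (h x); rewrite xU /= negb_exists => /forallP/(_ y); rewrite yU xy.
case/existsP => x /andP[xU /existsP[y /andP[yU wxy]]].
have xy : x != y by apply/eqP => e; rewrite e wxx in wxy.
have [T [cU sU eU [xT yT] ->]] := wsum_pair xU yU xy.
have : wsum T <= wmax #|T| by apply: IH; [lia|exact: heavyS hU].
have : \sum_(z in T) (w x z + w y z) <= 6 * #|T|.
  apply: sum_le_const => z zT; have := heavyN hU xU yU (subsetP sU _ zT); lia.
by move: (w4 x y) (wmaxE #|T|) (wmaxE #|U|); rewrite cU; lia.
Qed.

Lemma wsum_triangle U x y z : x \in U -> y \in U -> z \in U ->
  x != y -> x != z -> y != z ->
  exists T, [/\ #|U| = #|T|.+3, T \subset U, U = x |: (y |: (z |: T)),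
    [/\ x \notin T, y \notin T & z \notin T] &
    wsum U = 2 * (w x y + w x z + w y z)
      + 2 * (\sum_(t in T) (w x t + w y t + w z t)) + wsum T].
Proof.
move=> xU yU zU xy xz yz; case: (split_set xU) => T1 [eU xT -> sU].
have yT : y \in T1 by apply: sU; rewrite // eq_sym.
have zT1 : z \in T1 by apply: sU; rewrite // eq_sym.
case: (split_set yT) => T2 [eT1 yT2 -> sT1].
have zT2 : z \in T2 by apply: sT1; rewrite // eq_sym.
case: (split_set zT2) => T [eT2 zT -> _].
exists T; split=> //.
- by rewrite eU eT1 eT2; apply/subsetP => t tT; rewrite !inE tT !orbT.
- by rewrite eU eT1 eT2.
- by move: xT yT2; rewrite eT1 eT2 !inE !negb_or => /and3P[_ _ ->] /andP[_ ->].
rewrite eU eT1 eT2 wsumU1 -?eT2 -?eT1 // eT1 eT2 wsumU1 -?eT2 // eT2 wsumU1 //.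
rewrite !wdegU1 // -?eT2 // !big_split /= -/(wdeg x T) -/(wdeg y T) -/(wdeg z T).
move: (wsum T) (wdeg x T) (wdeg y T) (wdeg z T) (w x y) (w x z) (w y z).
by clear=> *; slia.
Qed.

(** Induction by removing a triangle of weight 12 or 11. Size 3 is excluded because a triangle of
    weight 12 gives 24, while [wmax 3] is 20. *)
Lemma wsum_max U : #|U| != 3 -> wsum U <= wmax #|U|.
Proof.
have [m] := ubnP #|U|; elim: m U => // m IH U Um U3.
case: (boolP (heavy U)) => [|hU]; last exact: (@wsum_light #|U|).
have triple_le T : #|T| = 3 -> wsum T <= 24.
  by case/wsum_triple => x [y [z [_ _ _ _ ->]]]; move: (w4 x y) (w4 x z) (w4 y z); slia.
case: (boolP [exists x in U, exists y in U, exists z in U,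
    [&& x != y, x != z, y != z & 12 <= w x y + w x z + w y z]]).
  case/existsP => x /andP[xU /existsP[y /andP[yU /existsP[z]]]].
  case/and5P => zU xy xz yz wxyz _.
  have [T [cU sU eU _ ->]] := wsum_triangle xU yU zU xy xz yz.
  (* By [four_set_le] a triangle of weight 12 leaves at most 8 for a fourth vertex. *)
  have : \sum_(t in T) (w x t + w y t + w z t) <= 8 * #|T|.
    apply: sum_le_const => t tT.
    have := four_set_le (w4 x y) (w4 x z) (w4 y z) (w4 x t) (w4 y t) (w4 z t) (wQ x y z t).
    by slia.
  (* With three remaining points the induction hypothesis does not apply, but the crude bound 24
     suffices. *)
  move: (w4 x y) (w4 x z) (w4 y z); case: (eqVneq #|T| 3) => [T3|T3].
    by have := triple_le _ T3; rewrite cU T3 /wmax /=; slia.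
  have : wsum T <= wmax #|T| by apply: IH; slia.
  by move: (wmaxE #|T|) (wmaxE #|U|) U3; rewrite cU; slia.
move=> no12; have le11 x y z : x \in U -> y \in U -> z \in U ->
    x != y -> x != z -> y != z -> w x y + w x z + w y z <= 11.
  move=> xU yU zU xy xz yz; rewrite leqNgt; apply: contra no12 => h.
  apply/existsP; exists x; rewrite xU; apply/existsP; exists y; rewrite yU.
  by apply/existsP; exists z; rewrite zU xy xz yz.
(* Triangles of weight 12 are now excluded, which sharpens the bound for the size outside the
   induction. *)
have {}triple_le T : T \subset U -> #|T| = 3 -> wsum T <= 22.
  move=> /subsetP TU /wsum_triple[x [y [z [/TU xU /TU yU /TU zU [xy xz yz] ->]]]].
  by have := le11 _ _ _ xU yU zU xy xz yz; slia.
case/existsP => x /andP[xU /existsP[y /andP[yU /existsP[z]]]].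
case/and5P => zU xy xz yz wxyz.
wlog wxy : x y z xU yU zU xy xz yz wxyz / w x y <= 3.
  move=> W; have := le11 _ _ _ xU yU zU xy xz yz.
  case: (leqP (w x y) 3) => [h _|h]; first exact: (W x y z).
  case: (leqP (w x z) 3) => [h' _|h']; first by apply: (W x z y); rewrite // 1?eq_sym // (wC z y); slia.
  by move=> h''; apply: (W y z x); rewrite // 1?eq_sym // ?(wC y x) ?(wC z x); slia.
have [wxy3 wxz4 wyz4] : [/\ w x y = 3, w x z = 4 & w y z = 4].
  by move: (w4 x z) (w4 y z); split; slia.
have [T [cU sU eU [xT yT zT] eW]] := wsum_triangle xU yU zU xy xz yz.
have le9 t : t \in T -> w x t + w y t + w z t <= 9.
  have := four_set_le (w4 x y) (w4 x z) (w4 y z) (w4 x t) (w4 y t) (w4 z t) (wQ x y z t).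
  by rewrite wxy3 wxz4 wyz4 -(leq_add2l 11).
have := sum_le_const le9.
(* If every vertex of [T] sends 9 to the triangle, then [z], opposite the pair of weight 3, has
   weight 1 to all of [T] and is removed alone. Otherwise the sum is below [9 * #|T|] and the whole
   triangle is removed. *)
case: (leqP (9 * #|T|) (\sum_(t in T) (w x t + w y t + w z t))) => [all9 _|lt9 _].
  have wz t : t \in T -> w z t = 1.
    move=> tT; have := sum_eq_const le9 all9 tT; apply: (four_set_eq wxy3 wxz4 wyz4 (w4 x t) (w4 y t) (w4 z t) (wQ x y z t)).
  have yN : y \notin T by [].
  have xN : x \notin y |: T by rewrite !inE negb_or xy.
  have zN : z \notin x |: (y |: T).
    by rewrite !inE !negb_or eq_sym xz eq_sym yz.
  have eU' : U = z |: (x |: (y |: T)).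
    by rewrite eU; apply/setP => t; rewrite !inE; case: (t == x); case: (t == y); case: (t == z).
  have cU' : #|x |: (y |: T)| = #|T|.+2 by rewrite !cardsU1 xN yN.
  have degz : wdeg z T = #|T| by rewrite /wdeg (eq_bigr (fun=> 1)) // sum1_card.
  rewrite eU' wsumU1 // !wdegU1 // degz -eU' cU (wC z x) (wC z y).
  move: (w4 x z) (w4 y z); case: (eqVneq #|T|.+2 3) => [T3|T3].
    have : wsum (x |: (y |: T)) <= 22.
      by apply: triple_le; rewrite ?cU' // eU' subsetUr.
    by move: cU U3; case: #|T| T3 => [|[|n]] //= _ ->; rewrite /wmax /=; slia.
  have : wsum (x |: (y |: T)) <= wmax #|x |: (y |: T)| by apply: IH; slia.
  by move: (wmaxE #|T|.+2) (wmaxE #|T|.+3) U3; rewrite cU' cU; slia.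
rewrite eW cU; move: (w4 x z) (w4 y z) (wxy).
case: (eqVneq #|T| 3) => [T3|T3].
  by have := triple_le _ sU T3; rewrite T3 in lt9 *; rewrite /wmax /=; slia.
have : wsum T <= wmax #|T| by apply: IH; slia.
by move: (wmaxE #|T|) (wmaxE #|T|.+3) U3; rewrite cU; slia.
Qed.
End Weights.

(** * Seven points *)

Definition triple := (nat * nat * nat)%type.

Definition in3 (i : nat) (t : triple) := [|| i == t.1.1, i == t.1.2 | i == t.2].

Definition sort3 (t : triple) : triple :=
  let: (i, j, k) := t in
  let: (i, j) := if i < j then (i, j) else (j, i) in
  if j < k then (i, j, k) else if i < k then (i, k, j) else (k, i, j).

Definition fano_lines : seq triple :=
  [:: (0, 1, 2); (2, 3, 4); (0, 4, 5); (0, 3, 6); (2, 5, 6); (1, 4, 6); (1, 3, 5)].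

(* The automorphism group of the Fano plane is simply transitive on ordered
   triples of non-collinear points, so every Fano plane on [0..6] comes from
   exactly one labelling with [0 |-> 0], [1 |-> 1] and [3] sent to the least
   remaining point off the line through [0] and [1]. *)
Definition labellings : seq (seq nat) :=
  [seq [:: 0, 1 & q] | q <- permutations (iota 2 5) & all (leq (nth 0 q 1)) (drop 2 q)].

Definition planes : seq (seq triple) :=
  [seq [seq sort3 (nth 0 q t.1.1, nth 0 q t.1.2, nth 0 q t.2) | t <- fano_lines]
  | q <- labellings].

Definition triples : seq triple :=
  [seq t <- [seq (ij, k) | ij <- [seq (i, j) | i <- iota 0 7, j <- iota 0 7], k <- iota 0 7]
  | (t.1.1 < t.1.2) && (t.1.2 < t.2)].

Arguments sort3 : simpl never.
Arguments planes : simpl never.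
Arguments triples : simpl never.

(* Branches over the triples of the first plane of [P], the list of those planes
   that avoid the triples [C] chosen so far. *)
Fixpoint search (P : seq (seq triple)) (chk : pred (seq triple)) (k : nat) (C : seq triple) : bool :=
  match P with
  | [::] => (k == 0) && chk C
  | p :: _ =>
    if k is k'.+1 then all (fun t => search [seq q <- P | t \notin q] chk k' (t :: C)) p
    else true
  end.

(** Every plane must be hit, so [M] contains a triple of the first surviving plane, and the proof
    follows that branch. Leaves demand [k == 0], so success also excludes hitting sets below the
    budget. *)
Lemma searchP P chk k (C M : seq triple) : search P chk k C -> uniq C -> uniq M ->
  {subset C <= M} -> size M <= size C + k -> all (has (mem M)) P ->
  (forall p, p \in P -> ~~ has (mem C) p) ->
  size M = size C + k /\ exists C', chk C' /\ C' =i M.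
Proof.
elim: k C P => [|k IH] C [|p P] //= + uC uM CM sM hP PC.
- move=> chkC; have sE : size M = size C.
    by apply/eqP; rewrite eqn_leq -{1}[size C]addn0 sM uniq_leq_size.
  rewrite addn0; split=> //; exists C; split=> // t.
  by case: (uniq_min_size uC CM _) => [|_ ->]; rewrite ?sE.
(* The budget is spent, so [C] is all of [M]; but [p] avoids [C] and must meet [M]. *)
- rewrite addn0 in sM; have [_ eCM] := uniq_min_size uC CM sM.
  have := PC p (mem_head _ _); case/andP: hP => + _.
  by rewrite (eq_has (a2 := mem C)) => [-> // | t /=]; rewrite eCM.
move=> /allP all_p; have pC := PC p (mem_head _ _).
have /hasP[t tp tM] : has (mem M) p by case/andP: hP.
have [] := IH (t :: C) _ (all_p t tp).
- by rewrite /= uC andbT; apply: contra pC => tC; apply/hasP; exists t.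
- by [].
- by move=> s; rewrite inE => /orP[/eqP-> //|/CM].
- by rewrite /= addSnnS.
- have /allP hP' : all (has (mem M)) (p :: P) by [].
  by apply/allP => q; rewrite -[if _ then _ else _]/([seq q <- p :: P | t \notin q]) mem_filter => /andP[_ /hP'].
- move=> q; rewrite -[if _ then _ else _]/([seq q <- p :: P | t \notin q]) mem_filter => /andP[tq /PC qC].
  by apply: contra qC => /hasP[s sq]; rewrite /= inE => /orP[/eqP es|sC]; [rewrite -es sq in tq|apply/hasP; exists s].
by rewrite /= addSnnS.
Qed.

Corollary searchP0 P chk k (M : seq triple) : search P chk k [::] -> uniq M ->
  size M <= k -> all (has (mem M)) P ->
  size M = k /\ exists C, chk C /\ C =i M.
Proof.
by move=> S uM sM hP; apply: (searchP S) => // p _; apply/hasPn.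
Qed.

(* The complement of five triples is J_7 if they share a pair, and B_7 if one of
   them is disjoint from the four others. *)
Definition pencil (C : seq triple) :=
  has (fun ij : nat * nat => all (fun t => in3 ij.1 t && in3 ij.2 t) C)
    [seq (i, j) | i <- iota 0 7, j <- iota i.+1 (6 - i)].

Definition split_off (C : seq triple) :=
  has (fun t : triple => all (fun s =>
    (s == t) || [&& ~~ in3 t.1.1 s, ~~ in3 t.1.2 s & ~~ in3 t.2 s]) C) C.

(** By exhaustive computation; this recognises the two extremal hypergraphs on seven points. *)
Lemma search_pencil_or_split : search planes (fun C => pencil C || split_off C) 5 [::].
Proof. by vm_compute. Qed.

(** One representative pair of triples meeting in exactly one point suffices, since the points can
    be relabelled. *)
Lemma search_no_meet1 :
  search planes (fun C => ~~ (((0, 1, 2) \in C) && ((0, 3, 4) \in C))) 5 [::].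
Proof. by vm_compute. Qed.

(** Meant for a K_5 on the points 0 to 4: with 30 edges present, 5 and 6 cannot both miss a pair of
    the clique. *)
Lemma search_no_K5 : search planes (fun C =>
  [|| has (fun t : triple => ~~ in3 5 t && ~~ in3 6 t) C,
      ~~ has (fun t => in3 5 t && ~~ in3 6 t) C |
      ~~ has (fun t => in3 6 t && ~~ in3 5 t) C]) 5 [::].
Proof. by vm_compute. Qed.

Section Seven.
Variables (V : Type) (h : V -> V -> V -> bool).
Hypothesis hC12 : forall x y z, h x y z = h y x z.
Hypothesis hC23 : forall x y z, h x y z = h x z y.
Hypothesis fano_free : forall a0 a1 a2 a3 a4 a5 a6, ~~
  [&& h a0 a1 a2, h a2 a3 a4, h a0 a4 a5, h a0 a3 a6, h a2 a5 a6, h a1 a4 a6 & h a1 a3 a5].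
Variable a : nat -> V.

Definition hit (t : triple) := h (a t.1.1) (a t.1.2) (a t.2).

Definition missing := [seq t <- triples | ~~ hit t].

Lemma hit_sort3 t : hit (sort3 t) = hit t.
Proof.
case: t => [[i j] k]; rewrite /hit /sort3.
case: (i < j); case: (_ < k); rewrite //=; try case: (_ < k) => //=.
all: first [done | by rewrite hC12 | by rewrite hC23 | by rewrite hC12 hC23
  | by rewrite hC23 hC12 | by rewrite hC12 hC23 hC12].
Qed.

(** A labelling turns [fano_lines] into a plane, one of whose lines is not an edge by [fano_free];
    sorting does not change [hit]. *)
Lemma planes_hit : all (has (mem missing)) planes.
Proof.
have planesE : all (all (mem triples)) planes by vm_compute.
apply/allP => p pP; have /allP sub := allP planesE _ pP.
case/mapP: pP sub => q _ -> sub.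
have : has (fun t => ~~ hit t) [seq sort3 (nth 0 q t.1.1, nth 0 q t.1.2, nth 0 q t.2) | t <- fano_lines].
  rewrite has_map (eq_has (a2 := predC (fun t : triple =>
    hit (nth 0 q t.1.1, nth 0 q t.1.2, nth 0 q t.2)))) => [|t /=]; last by rewrite hit_sort3.
  rewrite has_predC /= andbT; exact: fano_free.
case/hasP => t tp ht; apply/hasP; exists t => //.
by rewrite /= mem_filter ht; exact: sub.
Qed.

(** [missing] hits every plane, and a successful search with budget 5 leaves no room for a smaller
    hitting set. *)
Lemma missing_ge5 : 5 <= size missing.
Proof.
rewrite leqNgt; apply/negP => lt5.
have uM : uniq missing by rewrite filter_uniq.
have [|e _] := searchP0 search_no_K5 uM _ planes_hit; first exact: ltnW.
by rewrite e in lt5.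
Qed.

Lemma missing_search chk : search planes chk 5 [::] -> size missing <= 5 ->
  exists C, chk C /\ C =i missing.
Proof.
move=> S s5; have uM : uniq missing by rewrite filter_uniq.
by case: (searchP0 S uM s5 planes_hit).
Qed.

End Seven.

Lemma in3N (x y n m : nat) : x < y < 5 -> 4 < m -> m != n -> ~~ in3 m (x, y, n).
Proof. by rewrite /in3 /=; lia. Qed.

(** * Fano-free hypergraphs *)

(** A set of vertices of a tetrahedron, as four booleans so that Hall's condition can be checked by
    computation. *)
Definition color4 := (bool * bool * bool * bool)%type.

Definition card4 (A : color4) := let: (a, b, c, d) := A in a + b + c + d.

Definition has_color (A : color4) i := let: (a, b, c, d) := A in nth false [:: a; b; c; d] i.

Definition rainbow (A B C : color4) :=
  has (fun i => has (fun j => has (fun k =>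
    [&& uniq [:: i; j; k], has_color A i, has_color B j & has_color C k])
    (iota 0 4)) (iota 0 4)) (iota 0 4).

(* Hall's condition for three subsets of a four-element set. *)
Lemma rainbowN (A B C : color4) : ~~ rainbow A B C ->
  [|| card4 A == 0, card4 B == 0, card4 C == 0 | card4 A + card4 B + card4 C <= 6].
Proof.
pose bs := [:: false; true].
pose cs : seq color4 := [seq (abc, d) | abc <- [seq (ab, c) | ab <-
  [seq (a, b) | a <- bs, b <- bs], c <- bs], d <- bs].
have mem_cs D : D \in cs by case: D => [[[[] []] []] []].
have : all (fun A => all (fun B => all (fun C => rainbow A B C ||
  [|| card4 A == 0, card4 B == 0, card4 C == 0 | card4 A + card4 B + card4 C <= 6])
  cs) cs) cs by vm_compute.
by move=> /allP/(_ A (mem_cs A))/allP/(_ B (mem_cs B))/allP/(_ C (mem_cs C))/orP[->|].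
Qed.

(* [6 * b n] for [n >= 2], see [b_bmax6]. *)
Definition bmax6 n := 3 * ((n - 2) * (n./2 * uphalf n)).

Lemma bmax6_even k : bmax6 k.*2 + 6 * (k * k) = 6 * (k * k * k).
Proof. by rewrite /bmax6 doubleK uphalf_double; case: k => // k; lia. Qed.

Lemma bmax6_odd k : bmax6 k.*2.+1 + 3 * k = 6 * (k * k * k) + 3 * (k * k).
Proof.
by rewrite /bmax6 uphalfE /= uphalf_double doubleK; case: k => // k; lia.
Qed.

Lemma half_cases n : exists k, n = k.*2 \/ n = k.*2.+1.
Proof.
by exists n./2; rewrite -[X in X = _]odd_double_half -[X in _ \/ X = _]odd_double_half; case: (odd n); [right|left].
Qed.

(** The increment mirrors the removal of a tetrahedron: the maximal weight outside, five pairs for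
    each of the [m] outside points, and four edges. *)
Lemma bmax6_step m : 2 <= m -> bmax6 m.+4 = bmax6 m + 3 * wmax m + 30 * m + 24.
Proof.
have := wmaxE m; have [k [->|->]] := half_cases m.
  have := bmax6_even k; have := bmax6_even k.+2; rewrite !doubleS doubleK.
  by move: (bmax6 _) (bmax6 _) (wmax _) => *; lia.
have := bmax6_odd k; have := bmax6_odd k.+2; rewrite !doubleS /= uphalf_double.
by move: (bmax6 _) (bmax6 _) (wmax _) => *; lia.
Qed.

(* [N], [w] and [p] count the triples with 0, 1 and 2 vertices in the removed
   clique, each triple 6, 2 and 1 times. *)
Lemma K6_arith m N w p : 8 <= m + 6 ->
  2 * w <= 3 * (if m == 3 then 24 else wmax m) -> p <= 10 * m ->
  N <= (if 7 <= m then bmax6 m else m * (m.-1 * m.-2)) ->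
  N + 3 * w + 6 * p + 120 < bmax6 (m + 6).
Proof.
have [m7 _|m7] := leqP 7 m; last first.
  case: m m7 => [|[|[|[|[|[|[|m]]]]]]] //= _ _; rewrite /wmax /bmax6 /=; lia.
have -> : (m == 3) = false by apply/eqP => e; rewrite e in m7.
have := wmaxE m; rewrite (_ : m + 6 = m.+2.+4); last by rewrite !addnS addn0.
move: (wmax m) m7; have [k [->|->]] := half_cases m => W k7; rewrite ?doubleK /= ?uphalf_double.
  have := bmax6_even k; have := bmax6_even k.+3; rewrite !doubleS => *; lia.
have := bmax6_odd k; have := bmax6_odd k.+3; rewrite !doubleS => *; lia.
Qed.

(** The product [m * p] enters through [wsum_pairs_le]. The value 24 bounds the weight on three
    points, and 114 is six times 19, for six points without a K_6. *)
Lemma K5_arith m N w p : 8 <= m + 5 ->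
  4 * w <= 5 * (if m == 3 then 24 else wmax m) -> w + 2 * (m * p) <= 19 * (m * m.-1) + 2 * p ->
  N <= (if 7 <= m then bmax6 m else if m == 6 then 114 else m * (m.-1 * m.-2)) ->
  N + 3 * w + 6 * p + 60 < bmax6 (m + 5).
Proof.
have [m7 _|m7] := leqP 7 m; last first.
  case: m m7 => [|[|[|[|[|[|[|m]]]]]]] //= _ _; rewrite /wmax /bmax6 /=; lia.
have -> : (m == 3) = false by apply/eqP => e; rewrite e in m7.
have := wmaxE m; rewrite (_ : m + 5 = m.+1.+4); last by rewrite !addnS addn0.
move: (wmax m) m7; have [k [->|->]] := half_cases m => W k7; rewrite ?doubleK /= ?uphalf_double => eW w_le p_le N_le.
  have := bmax6_even k; have := bmax6_odd k.+2.
  case: k k7 eW w_le p_le N_le => // j j7 eW w_le p_le N_le; rewrite !doubleS => eB5 eB.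
  (* The bound on [p] carries the factor [2 * (m - 1)], so the goal is multiplied by [4 * (m - 1)].
     After eliminating [p], the coefficient of [w] is [12 * (m - 2)], which is why [w_le] is scaled
     by [m - 2], here [j.*2]. *)
  have ww := leq_mul (leqnn j.*2) w_le; have NN := leq_mul (leqnn j.*2.+1) N_le.
  have eWj := congr1 (muln j) eW; have eBj := congr1 (muln j) eB; have eB5j := congr1 (muln j) eB5.
  rewrite -(ltn_pmul2l (_ : 0 < 4 * j.*2.+1)) //.
  move: (bmax6 _) (bmax6 _) eB eB5 eBj eB5j ww NN N_le => B B5 *; move: p_le; rewrite ?doubleS /= => *; lia.
have := bmax6_odd k; have := bmax6_even k.+3.
case: k k7 eW w_le p_le N_le => // j j7 eW w_le p_le N_le; rewrite !doubleS => eB5 eB.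
have ww := leq_mul (leqnn j.*2.+1) w_le; have NN := leq_mul (leqnn j.*2.+2) N_le.
have eWj := congr1 (muln j) eW; have eBj := congr1 (muln j) eB; have eB5j := congr1 (muln j) eB5.
rewrite -(ltn_pmul2l (_ : 0 < 4 * j.*2.+2)) //.
move: (bmax6 _) (bmax6 _) eB eB5 eBj eB5j ww NN N_le => B B5 *; move: p_le; rewrite ?doubleS /= => *; lia.
Qed.

Lemma pick_split (V : finType) (U : {set V}) n : #|U| = n.+1 ->
  exists x T, [/\ U = x |: T, x \notin T & #|T| = n].
Proof.
move=> cU; case: (set_0Vmem U) => [e|[x xU]]; first by rewrite e cards0 in cU.
case: (split_set xU) => T [eU xT eT _]; exists x, T; split=> //.
by move: cU; rewrite eT => -[].
Qed.

(** The hypothesis is summed over ordered pairs of distinct points, where each [p y] occurs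
    [2 * (#|T| - 1)] times; the terms are arranged to avoid subtraction. *)
Lemma wsum_pairs_le (V : finType) (T : {set V}) (w : V -> V -> nat) (p : V -> nat) c :
  (forall y, w y y = 0) ->
  (forall y z, y \in T -> z \in T -> w y z + p y + p z <= c) ->
  wsum w T + 2 * (#|T| * \sum_(z in T) p z) <=
    c * (#|T| * #|T|.-1) + 2 * \sum_(z in T) p z.
Proof.
move=> wxx wp; set P := \sum_(z in T) p z.
have : \sum_(y in T) (wdeg w y T + #|T| * p y + P) <= \sum_(y in T) (c * #|T|.-1 + 2 * p y).
  apply: leq_sum => y yT.
  have : \sum_(z in T) (w y z + p y + p z) <= c * #|T|.-1 + 2 * p y.
    rewrite (big_setD1 y) //= wxx addnC mul2n -addnn leq_add2r.
    have -> : #|T|.-1 = #|T :\ y| by rewrite (cardsD1 y T) yT.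
    by apply: sum_le_const => z; rewrite !inE => /andP[_ zT]; exact: wp.
  by rewrite !big_split /= sum_nat_const.
rewrite !big_split /= !sum_nat_const -!big_distrr /= -/P -/(wsum w T).
by move: (wsum w T) P; clear=> *; lia.
Qed.

(** * Links and edge counts of a Fano-free hypergraph *)

Section Hypergraph.
Variables (V : finType) (h : V -> V -> V -> bool).
Hypothesis hC12 : forall x y z, h x y z = h y x z.
Hypothesis hC23 : forall x y z, h x y z = h x z y.
Hypothesis hxx : forall x z, h x x z = false.
Hypothesis fano_free : forall a0 a1 a2 a3 a4 a5 a6, ~~
  [&& h a0 a1 a2, h a2 a3 a4, h a0 a4 a5, h a0 a3 a6, h a2 a5 a6, h a1 a4 a6 & h a1 a3 a5].
Implicit Types (x y z : V) (U T : {set V}).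

Definition lk x y z : nat := h x y z.

Lemma lkC x y z : lk x y z = lk x z y. Proof. by rewrite /lk hC23. Qed.
Lemma lkC12 x y z : lk x y z = lk y x z. Proof. by rewrite /lk hC12. Qed.
Lemma lkxx x y : lk x y y = 0. Proof. by rewrite /lk hC12 hC23 hxx. Qed.
Lemma lkxxl x y : lk x x y = 0. Proof. by rewrite /lk hxx. Qed.
Lemma lk_le1 x y z : lk x y z <= 1. Proof. by rewrite /lk; case: (h x y z). Qed.

Lemma wsumD (f g : V -> V -> nat) U :
  wsum (fun y z => f y z + g y z) U = wsum f U + wsum g U.
Proof.
rewrite /wsum -big_split; apply: eq_bigr => x _; exact: big_split.
Qed.

Lemma wsum_lkU1 s x U : x \notin U ->
  wsum (lk s) (x |: U) = wsum (lk s) U + 2 * wdeg (lk s) x U.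
Proof. by apply: wsumU1; [exact: lkC|exact: lkxx]. Qed.

Lemma wdeg_lkC s x U : wdeg (lk s) x U = wdeg (lk x) s U.
Proof. by apply: eq_bigr => z _; exact: lkC12. Qed.

Lemma wdeg_lkxx x U : wdeg (lk x) x U = 0.
Proof. by rewrite /wdeg big1 // => z _; exact: lkxxl. Qed.

(* Six times the number of edges inside [U]. *)
Definition edges6 U := \sum_(x in U) wsum (lk x) U.

Lemma edges6_set0 : edges6 set0 = 0.
Proof. by rewrite /edges6 big_set0. Qed.

Lemma edges6U1 x U : x \notin U -> edges6 (x |: U) = edges6 U + 3 * wsum (lk x) U.
Proof.
move=> xU; rewrite /edges6 big_setU1 //= wsum_lkU1 // wdeg_lkxx.
under eq_bigr => y _ do rewrite wsum_lkU1 // wdeg_lkC.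
rewrite big_split /= -big_distrr /= -/(wsum (lk x) U); lia.
Qed.

Lemma wsum_lk_le x U : wsum (lk x) U <= #|U| * #|U|.-1.
Proof. by rewrite -[leqRHS]mul1n; apply: wsum_le => // [y|y z _ _]; [exact: lkxx|exact: lk_le1]. Qed.

Lemma edges6_le U : edges6 U <= #|U| * (#|U|.-1 * #|U|.-2).
Proof.
have [m] := ubnP #|U|; elim: m U => // m IH U Um.
case: (set_0Vmem U) => [->|[x xU]]; first by rewrite edges6_set0.
case: (split_set xU) => T [eU xT cU _]; rewrite cU in Um; rewrite eU edges6U1 // cardsU1 xT add1n.
have := wsum_lk_le x T; have : edges6 T <= #|T| * (#|T|.-1 * #|T|.-2) by apply: IH; lia.
by case: #|T| => [|[|n]]; move: (edges6 T) (wsum _ _) => /= *; lia.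
Qed.

Lemma edges6D1 x U : x \in U -> edges6 U = edges6 (U :\ x) + 3 * wsum (lk x) U.
Proof.
move=> xU; rewrite -{1 3}(setD1K xU) edges6U1 ?setD11 // wsum_lkU1 ?setD11 //.
by rewrite wdeg_lkxx addn0.
Qed.

(** An edge survives the deletion of a vertex unless it is one of its own three. *)
Lemma edges6_average U : \sum_(x in U) edges6 (U :\ x) + 3 * edges6 U = #|U| * edges6 U.
Proof.
rewrite -sum_nat_const (eq_bigr _ (fun x xU => edges6D1 xU)) big_split /=.
by rewrite -big_distrr.
Qed.

Lemma edges6_average_le q U c : (forall x, x \in U -> q * edges6 (U :\ x) <= c) ->
  q * (#|U| * edges6 U) <= c * #|U| + q * (3 * edges6 U).
Proof.
move=> /sum_le_const; rewrite -edges6_average mulnDr leq_add2r.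
by rewrite -big_distrr.
Qed.

Section SevenPoints.
Variables a0 a1 a2 a3 a4 a5 a6 : V.

(** Written out term by term, so that [lia] can compare it with sums of links and it can be matched
    with the list [triples]. *)
Definition edges7 :=
  lk a0 a1 a2 + lk a0 a1 a3 + lk a0 a1 a4 + lk a0 a1 a5 + lk a0 a1 a6 +
  lk a0 a2 a3 + lk a0 a2 a4 + lk a0 a2 a5 + lk a0 a2 a6 + lk a0 a3 a4 +
  lk a0 a3 a5 + lk a0 a3 a6 + lk a0 a4 a5 + lk a0 a4 a6 + lk a0 a5 a6 +
  lk a1 a2 a3 + lk a1 a2 a4 + lk a1 a2 a5 + lk a1 a2 a6 + lk a1 a3 a4 +
  lk a1 a3 a5 + lk a1 a3 a6 + lk a1 a4 a5 + lk a1 a4 a6 + lk a1 a5 a6 +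
  lk a2 a3 a4 + lk a2 a3 a5 + lk a2 a3 a6 + lk a2 a4 a5 + lk a2 a4 a6 +
  lk a2 a5 a6 + lk a3 a4 a5 + lk a3 a4 a6 + lk a3 a5 a6 + lk a4 a5 a6.

Let a := nth a0 [:: a0; a1; a2; a3; a4; a5; a6].

Lemma edges7_missing : edges7 + size (missing h a) = 35.
Proof.
have -> : 35 = count (hit h a) triples + count (predC (hit h a)) triples.
  by rewrite count_predC.
rewrite size_filter; congr (_ + _).
rewrite -sum1_count big_mkcond (eq_bigr (fun t => lk (a t.1.1) (a t.1.2) (a t.2))) => [|t _].
  have -> : triples = ltac:(let t := eval vm_compute in triples in exact t) by vm_compute.
  by rewrite !big_cons big_nil /a /edges7 /= addn0 !addnA.
by rewrite /hit /lk; case: (h _ _ _).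
Qed.

Lemma edges7_le : edges7 <= 30.
Proof.
by rewrite -(leq_add2r (size (missing h a))) edges7_missing (leq_add2l 30 5) missing_ge5.
Qed.

Lemma missing_le5 : 30 <= edges7 -> size (missing h a) <= 5.
Proof. by rewrite -(leq_add2l 30 _ 5) -[30 + 5]edges7_missing leq_add2r. Qed.

Lemma edges7_no_meet1 : 30 <= edges7 -> ~~ h a0 a1 a2 -> h a0 a3 a4.
Proof.
move=> /missing_le5 e30 h012; case: (boolP (h a0 a3 a4)) => // h034.
have [C [+ CM]] := missing_search hC12 hC23 fano_free search_no_meet1 e30.
by rewrite !CM !mem_filter /hit /= h012 h034.
Qed.

Lemma edges7_no_K5 i j k l : i < j < 5 -> k < l < 5 ->
  ~~ h (a i) (a j) a5 -> ~~ h (a k) (a l) a6 ->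
  [&& h a0 a1 a2, h a0 a1 a3, h a0 a1 a4, h a0 a2 a3, h a0 a2 a4, h a0 a3 a4,
      h a1 a2 a3, h a1 a2 a4, h a1 a3 a4 & h a2 a3 a4] -> edges7 <= 29.
Proof.
move=> ij kl h5 h6 K; rewrite leqNgt; apply/negP => /missing_le5 e30.
have mem_triples (n x y : nat) : (n == 5) || (n == 6) -> x < y < 5 -> (x, y, n) \in triples.
  move=> n56 /andP[xy y5]; suff /allP/(_ y)/[!mem_iota]/(_ y5)/allP/(_ x)/[!mem_iota]/(_ xy):
    all (fun y : nat => all (fun x : nat => (x, y, n) \in triples) (iota 0 y)) (iota 0 5) by [].
  by case/orP: n56 => /eqP->; vm_compute.
have mem5 : (i, j, 5) \in missing h a by rewrite mem_filter /hit h5 mem_triples.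
have mem6 : (k, l, 6) \in missing h a by rewrite mem_filter /hit h6 mem_triples.
have [C [+ CM]] := missing_search hC12 hC23 fano_free search_no_K5 e30.
case/or3P.
- pose ten := [:: (0, 1, 2); (0, 1, 3); (0, 1, 4); (0, 2, 3); (0, 2, 4); (0, 3, 4);
                  (1, 2, 3); (1, 2, 4); (1, 3, 4); (2, 3, 4)].
  have /allP tenP : all (fun t => (~~ in3 5 t && ~~ in3 6 t) ==> (t \in ten)) triples.
    by vm_compute.
  have /allP K' : all (hit h a) ten by rewrite /= /hit /= andbT.
  case/hasP => t; rewrite CM mem_filter => /andP[/negP ht tt] t56; apply: ht.
  by apply: K'; move: (tenP t tt); rewrite t56.
- by move/hasPn/(_ (i, j, 5)); rewrite CM in3N // /in3 eqxx !orbT => /(_ mem5).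
- by move/hasPn/(_ (k, l, 6)); rewrite CM in3N // /in3 eqxx !orbT => /(_ mem6).
Qed.
End SevenPoints.

(* The line [pqr], and one perfect matching of [{u, v, x, y}] in each link. *)
Lemma no_fano p q r u v x y : h p q r -> h p u v -> h p x y ->
  h q u x -> h q v y -> h r u y -> h r v x -> False.
Proof.
move=> pqr puv pxy qux qvy ruy rvx.
have /negP[] := fano_free p u v x r q y.
have -> : h v x r by rewrite hC23 hC12.
have -> : h p r q by rewrite hC23.
have -> : h v q y by rewrite hC12.
have -> : h u r y by rewrite hC12.
have -> : h u x q by rewrite hC23 hC12.
by rewrite puv pxy.
Qed.

(** * Tetrahedra and the weights of their links *)

Definition K4 a b c d := [&& h a b c, h a b d, h a c d & h b c d].
Definition link4 a b c d y z := lk a y z + lk b y z + lk c y z + lk d y z.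
Definition pairs4 a b c d z :=
  lk a b z + lk a c z + lk a d z + lk b c z + lk b d z + lk c d z.

Lemma K4_line a b c d i j k : K4 a b c d -> i < 4 -> j < 4 -> k < 4 -> uniq [:: i; j; k] ->
  let s := nth a [:: a; b; c; d] in h (s i) (s j) (s k).
Proof.
case/and4P => abc abd acd bcd.
case: i j k => [|[|[|[|i]]]] [|[|[|[|j]]]] [|[|[|[|k]]]] //= _ _ _ _.
all: first [done | by rewrite hC12 | by rewrite hC23 | by rewrite hC12 hC23
  | by rewrite hC23 hC12 | by rewrite hC12 hC23 hC12].
Qed.

Section Link4.
Variables a b c d : V.
Hypothesis abcd : K4 a b c d.
Let w := link4 a b c d.

Lemma link4C y z : w y z = w z y.
Proof. by rewrite /w /link4 !(lkC _ y). Qed.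

Lemma link4xx y : w y y = 0.
Proof. by rewrite /w /link4 !lkxx. Qed.

Lemma link4_le y z : w y z <= 4.
Proof. by rewrite -[4]/(1 + 1 + 1 + 1) !leq_add ?lk_le1. Qed.

(** A matching has the colours of those tetrahedron vertices whose links contain both its pairs.
    Distinct colours for the three matchings would give a Fano plane by [no_fano], so Hall's
    condition fails; and a matching of weight [4 + t] has at least [t] colours. *)
Lemma link4_four_set u v x y :
  [|| w u v + w x y <= 4, w u x + w v y <= 4, w u y + w v x <= 4 |
      (w u v + w x y) + (w u x + w v y) + (w u y + w v x) <= 18].
Proof.
pose M u v x y : color4 := (h a u v && h a x y, h b u v && h b x y,
                            h c u v && h c x y, h d u v && h d x y).
have M_le u' v' x' y' : w u' v' + w x' y' <= 4 + card4 (M u' v' x' y').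
  rewrite /w /link4 /M /card4 /lk.
  case: (h a u' v'); case: (h b u' v'); case: (h c u' v'); case: (h d u' v');
  by case: (h a x' y'); case: (h b x' y'); case: (h c x' y'); case: (h d x' y').
have M_color u' v' x' y' i : has_color (M u' v' x' y') i ->
    let s := nth a [:: a; b; c; d] in h (s i) u' v' && h (s i) x' y'.
  by case: i => [|[|[|[|i]]]] //=; rewrite nth_nil.
have /rainbowN : ~~ rainbow (M u v x y) (M u x v y) (M u y v x).
  apply/negP => /hasP[i i4 /hasP[j j4 /hasP[k k4 /and4P[uijk]]]].
  move: i4 j4 k4; rewrite !mem_iota /= => i4 j4 k4.
  move=> /M_color/andP[iuv ixy] /M_color/andP[jux jvy] /M_color/andP[kuy kvx].
  exact: no_fano (K4_line abcd i4 j4 k4 uijk) iuv ixy jux jvy kuy kvx.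
move: (M_le u v x y) (M_le u x v y) (M_le u y v x).
move: (card4 _) (card4 _) (card4 _) (w u v + _) (w u x + _) (w u y + _).
by clear; lia.
Qed.

Lemma wsum_link4 U : wsum w U = wsum (lk a) U + wsum (lk b) U + wsum (lk c) U + wsum (lk d) U.
Proof. by rewrite /w /link4 !wsumD. Qed.

Lemma wsum_link4_max U : #|U| != 3 -> wsum w U <= wmax #|U|.
Proof. exact: (wsum_max link4C link4xx link4_le link4_four_set). Qed.

Lemma wsum_link4_max3 U : #|U| = 3 -> wsum w U <= 24.
Proof.
move=> U3; have := wsum_le link4xx (c := 4) (U := U) (fun x y _ _ => link4_le x y).
by rewrite U3.
Qed.
End Link4.


Lemma edges6U4 a b c d T : a \notin b |: (c |: (d |: T)) -> b \notin c |: (d |: T) ->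
  c \notin d |: T -> d \notin T ->
  edges6 (a |: (b |: (c |: (d |: T)))) =
    edges6 T + 3 * wsum (link4 a b c d) T + 6 * (\sum_(z in T) pairs4 a b c d z)
    + 6 * (lk a b c + lk a b d + lk a c d + lk b c d).
Proof.
move=> aT bT cT dT; rewrite !edges6U1 // !wsum_lkU1 // !wdegU1 // wsum_link4 // !big_split /=.
by rewrite /wdeg; move: (edges6 T) => *; lia.
Qed.

Lemma edges6_edges7 U : #|U| = 7 -> exists a0 a1 a2 a3 a4 a5 a6,
  [/\ uniq [:: a0; a1; a2; a3; a4; a5; a6], U =i [:: a0; a1; a2; a3; a4; a5; a6] &
      edges6 U = 6 * edges7 a0 a1 a2 a3 a4 a5 a6].
Proof.
move=> /pick_split[a0 [U1 [-> u1 /pick_split[a1 [U2 [eU1 u2]]]]]].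
move=> /pick_split[a2 [U3 [eU2 u3 /pick_split[a3 [U4 [eU3 u4]]]]]].
move=> /pick_split[a4 [U5 [eU4 u5 /pick_split[a5 [U6 [eU5 u6]]]]]].
move=> /pick_split[a6 [U7 [eU6 u7 /eqP]]]; rewrite cards_eq0 => /eqP eU7.
move: u1 u2 u3 u4 u5 u6 u7; rewrite eU1 eU2 eU3 eU4 eU5 eU6 eU7 => u1 u2 u3 u4 u5 u6 u7.
exists a0, a1, a2, a3, a4, a5, a6; split.
- by move: u1 u2 u3 u4 u5 u6; rewrite /= !inE !orbF => -> -> -> -> -> ->.
- by move=> x; rewrite !inE orbF.
rewrite !edges6U1 // !wsum_lkU1 // !wsum_set0 !wdegU1 // !wdeg_set0 edges6_set0 /edges7.
by move: lk => l; clear; lia.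
Qed.

Lemma edges6_7 U : #|U| = 7 -> edges6 U <= 180.
Proof.
case/edges6_edges7 => a0 [a1 [a2 [a3 [a4 [a5 [a6 [_ _ ->]]]]]]].
by rewrite -[180]/(6 * 30) leq_mul2l edges7_le.
Qed.

Lemma h_neq x y z : h x y z -> [/\ x != y, x != z & y != z].
Proof.
move=> xyz; split; apply/eqP => e; move: xyz; rewrite e ?hxx //.
- by rewrite hC23 hxx.
- by rewrite hC12 hC23 hxx.
Qed.

Lemma K4_split U a b c d : K4 a b c d -> a \in U -> b \in U -> c \in U -> d \in U ->
  exists T, [/\ U = a |: (b |: (c |: (d |: T))), #|U| = #|T|.+4, T \subset U &
    [/\ a \notin b |: (c |: (d |: T)), b \notin c |: (d |: T),
      c \notin d |: T & d \notin T]].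
Proof.
case/and4P => /h_neq[ab ac bc] /h_neq[_ ad bd] /h_neq[_ _ cd] _ aU bU cU dU.
case: (split_set aU) => T1 [eU a1 -> sU].
have b1 : b \in T1 by apply: sU; rewrite // eq_sym.
have c1 : c \in T1 by apply: sU; rewrite // eq_sym.
have d1 : d \in T1 by apply: sU; rewrite // eq_sym.
case: (split_set b1) => T2 [e1 b2 -> s1].
have c2 : c \in T2 by apply: s1; rewrite // eq_sym.
have d2 : d \in T2 by apply: s1; rewrite // eq_sym.
case: (split_set c2) => T3 [e2 c3 -> s2].
have d3 : d \in T3 by apply: s2; rewrite // eq_sym.
case: (split_set d3) => T [e3 d4 -> _].
exists T; rewrite -e3 -e2 -e1 -eU; split=> //.
by apply/subsetP => t tT; rewrite eU e1 e2 e3 !inE tT !orbT.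
Qed.

(** Four points span at most three of their four triples, and averaging over vertex deletions
    carries the density 3/4 upwards. *)
Lemma edges6_K4free U : 4 <= #|U| ->
  (forall a b c d, a \in U -> b \in U -> c \in U -> d \in U -> ~~ K4 a b c d) ->
  4 * edges6 U <= 3 * (#|U| * (#|U|.-1 * #|U|.-2)).
Proof.
have [m] := ubnP #|U|; elim: m U => // m IH U Um.
rewrite leq_eqVlt => /orP[/eqP/esym cU|cU] noK4.
  rewrite cU; move: cU noK4 => /pick_split[a [U1 [-> u1 /pick_split[b [U2 [eU1 u2]]]]]].
  move=> /pick_split[c [U3 [eU2 u3 /pick_split[d [U4 [eU3 u4 /eqP]]]]]].
  rewrite cards_eq0 => /eqP eU4; move: u1 u2 u3 u4.
  rewrite eU1 eU2 eU3 eU4 => u1 u2 u3 u4 noK4; rewrite edges6U4 //.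
  have := noK4 a b c d; rewrite !inE !eqxx !orbT => /(_ isT isT isT isT).
  rewrite /K4 edges6_set0 wsum_set0 big_set0 /lk.
  by case: (h a b c); case: (h a b d); case: (h a c d); case: (h b c d).
have /edges6_average_le : forall x, x \in U ->
    4 * edges6 (U :\ x) <= 3 * (#|U|.-1 * (#|U|.-2 * #|U|.-2.-1)).
  move=> x xU; have cUx : #|U :\ x| = #|U|.-1 by rewrite (cardsD1 x U) xU.
  rewrite -cUx; apply: IH; rewrite ?cUx; first by lia.
    by lia.
  move=> a b c d; rewrite !inE => /andP[_ aU] /andP[_ bU] /andP[_ cU'] /andP[_ dU].
  exact: noK4.
case: #|U| cU => [|[|[|[|n]]]] //= _ h4; rewrite -(leq_pmul2r (isT : 0 < n.+1)).
by move: (edges6 U) h4 => N; lia.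
Qed.

Lemma edges6_K4free_lt U : 4 <= #|U| ->
  (forall a b c d, a \in U -> b \in U -> c \in U -> d \in U -> ~~ K4 a b c d) ->
  edges6 U < bmax6 #|U|.
Proof.
move=> U4 /(edges6_K4free U4); move: (edges6 U) U4 => N.
have [k [->|->]] := half_cases #|U|.
  by have := bmax6_even k; case: k => [|[|k]] // + _; rewrite !doubleS /=; lia.
by have := bmax6_odd k; case: k => [|[|k]] // + _; rewrite !doubleS /=; lia.
Qed.

Lemma K4_dec U : (exists a b c d, [/\ a \in U, b \in U, c \in U, d \in U & K4 a b c d]) \/
  (forall a b c d, a \in U -> b \in U -> c \in U -> d \in U -> ~~ K4 a b c d).
Proof.
case: (boolP [forall a in U, forall b in U, forall c in U, forall d in U, ~~ K4 a b c d]).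
  move=> /forall_inP H; right=> a b c d aU bU cU dU.
  by move: (H a aU) => /forall_inP/(_ b bU)/forall_inP/(_ c cU)/forall_inP/(_ d dU).
rewrite negb_forall_in => /exists_inP[a aU]; rewrite negb_forall_in => /exists_inP[b bU].
rewrite negb_forall_in => /exists_inP[c cU]; rewrite negb_forall_in => /exists_inP[d dU].
by rewrite negbK => K; left; exists a, b, c, d.
Qed.

Lemma pairs4_le a b c d z : pairs4 a b c d z <= 6.
Proof. by rewrite -[6]/(1 + 1 + 1 + 1 + 1 + 1) !leq_add ?lk_le1. Qed.

(** * Hypergraphs without K_5 *)

Definition K5 a b c d e := K4 a b c d && (pairs4 a b c d e == 6).

Definition K5_free U := forall a b c d e,
  a \in U -> b \in U -> c \in U -> d \in U -> e \in U -> ~~ K5 a b c d e.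

Lemma K5_freeS U T : T \subset U -> K5_free U -> K5_free T.
Proof. by move=> /subsetP TU UK a b c d e *; apply: UK; apply: TU. Qed.

Lemma K5_free_pairs4 U a b c d z : K5_free U -> K4 a b c d ->
  a \in U -> b \in U -> c \in U -> d \in U -> z \in U -> pairs4 a b c d z <= 5.
Proof.
move=> UK K aU bU cU dU zU; have := UK _ _ _ _ _ aU bU cU dU zU.
by rewrite /K5 K /= => p6; rewrite -ltnS ltn_neqAle p6 pairs4_le.
Qed.

Lemma K4_count a b c d : K4 a b c d -> lk a b c + lk a b d + lk a c d + lk b c d = 4.
Proof. by rewrite /K4 /lk => /and4P[-> -> -> ->]. Qed.

Lemma edges6_K5free_5 U : #|U| = 5 -> K5_free U -> edges6 U <= 54.
Proof.
move=> /pick_split[a [U1 [-> u1 /pick_split[b [U2 [eU1 u2]]]]]].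
move=> /pick_split[c [U3 [eU2 u3 /pick_split[d [U4 [eU3 u4]]]]]].
move=> /eqP/cards1P[e eU4]; move: u1 u2 u3 u4.
rewrite eU1 eU2 eU3 eU4 => u1 u2 u3 u4 UK.
rewrite edges6U4 // big_set1 -(setU0 [set e]) edges6U1 ?inE // edges6_set0 wsum_set0.
rewrite wsum_link4 !wsum_lkU1 ?inE // !wsum_set0 !wdeg_set0 !muln0 !addn0 !add0n.
have := UK a b c d e; rewrite !inE !eqxx !orbT => /(_ isT isT isT isT isT).
have := pairs4_le a b c d e; rewrite /K5 /K4 /lk; move: (pairs4 a b c d e) => p.
by case: (h a b c); case: (h a b d); case: (h a c d); case: (h b c d); rewrite /= ?addn0; lia.
Qed.

(** A tetrahedron is removed, and each outside point forms an edge with at most five of its pairs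
    because there is no K_5; [bmax6_step] adds this up. Size 6 follows from size 5 by averaging. *)
Lemma edges6_K5free U : 4 <= #|U| -> K5_free U -> edges6 U <= bmax6 #|U|.
Proof.
have [m] := ubnP #|U|; elim: m U => // m IH U Um U4 UK.
(* From eight points on, at least four remain after the removal: the induction hypothesis applies,
   and the exceptional size 3 of [wsum_link4_max] does not occur. *)
have [U7|U8] := leqP #|U| 7.
  have: [|| #|U| == 4, #|U| == 5, #|U| == 6 | #|U| == 7] by move: U4 U7; clear; lia.
  case/or4P => /eqP cU; rewrite cU.
  - by apply: leq_trans (edges6_le U) _; rewrite cU.
  - exact: edges6_K5free_5.
  - have /edges6_average_le : forall x, x \in U -> 1 * edges6 (U :\ x) <= 54.
      move=> x xU; rewrite mul1n; apply: edges6_K5free_5; last exact: K5_freeS (subsetDl _ _) UK.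
      by apply/eqP; rewrite -(eqn_add2l 1) -{1}[1]/(true : nat) -{1}xU -cardsD1 cU.
    by rewrite cU /bmax6 /=; move: (edges6 U) => N; lia.
  - exact: edges6_7.
case: (K4_dec U) => [|/(edges6_K4free_lt U4)/ltnW //].
case=> a [b [c [d [aU bU cU dU K]]]].
have [T [eU cT sT [aN bN cN dN]]] := K4_split K aU bU cU dU.
rewrite cT eU edges6U4 // K4_count // bmax6_step; last by move: U8; rewrite cT; clear; lia.
have TK := K5_freeS sT UK.
have : edges6 T <= bmax6 #|T| by apply: IH => //; move: Um U8; rewrite cT; clear; lia.
have : wsum (link4 a b c d) T <= wmax #|T|.
  by apply: wsum_link4_max => //; move: U8; rewrite cT; clear; lia.
have : \sum_(z in T) pairs4 a b c d z <= 5 * #|T|.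
  by apply: sum_le_const => z zT; apply: (K5_free_pairs4 UK) => //; exact: (subsetP sT).
by move: (edges6 T) (wsum _ T) (\sum_(z in T) _); clear=> *; lia.
Qed.

(** * Removing a clique on five or six points *)

Definition pairs5 a b c d e z := pairs4 a b c d z + (lk a e z + lk b e z + lk c e z + lk d e z).

Lemma pairs5_all a b c d e z : pairs5 a b c d e z = 10 ->
  [&& h a b z, h a c z, h a d z, h b c z &
      [&& h b d z, h c d z, h a e z, h b e z & h c e z && h d e z]].
Proof.
rewrite /pairs5 /pairs4 /lk.
move: (h a b z) (h a c z) (h a d z) (h b c z) (h b d z) (h c d z) (h a e z) (h b e z).
by move: (h c e z) (h d e z); clear; lia.
Qed.

Definition K6 a b c d e f := K5 a b c d e && (pairs5 a b c d e f == 10).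

Lemma K5_K4 a b c d e : K5 a b c d e ->
  [/\ K4 a b c d, K4 a b c e, K4 a b d e, K4 a c d e & K4 b c d e].
Proof.
case/andP => /and4P[abc abd acd bcd]; rewrite /K4 abc abd acd bcd /pairs4 /lk.
by case: (h a b e); case: (h a c e); case: (h a d e); case: (h b c e); case: (h b d e);
  case: (h c d e).
Qed.

(** The constant 60 is six times the ten edges of the clique. The clause on membership serves to
    find a sixth clique vertex inside [T] in [K6_split]. *)
Lemma K5_split U a b c d e : K5 a b c d e ->
  a \in U -> b \in U -> c \in U -> d \in U -> e \in U ->
  exists T, [/\ #|U| = #|T| + 5, T \subset U,
    forall x, x \in U -> x \notin [:: a; b; c; d; e] -> x \in T &
    edges6 U = edges6 T + 3 * (wsum (link4 a b c d) T + wsum (lk e) T)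
      + 6 * (\sum_(z in T) pairs5 a b c d e z) + 60].
Proof.
move=> K aU bU cU dU eU; have [K0 Kabce _ _ Kbcde] := K5_K4 K.
have [T0 [sU cT sT [aN bN cN dN]]] := K4_split K0 aU bU cU dU.
have [/and4P[_ /h_neq[_ ae be] _ _] /and4P[_ _ _ /h_neq[_ ce de]]] := conj Kabce Kbcde.
have eT0 : e \in T0.
  by move: eU; rewrite sU !inE ![e == _]eq_sym (negPf ae) (negPf be) (negPf ce) (negPf de).
have [T [eT0' eT cT0 sT0]] := split_set eT0.
exists T; split; first by rewrite cT cT0; clear; lia.
- by apply: subset_trans sT; rewrite eT0' subsetUr.
- move=> x xU; rewrite !inE !negb_or => /and5P[xa xb xc xd xe]; apply: sT0 => //.
  by move: xU; rewrite sU !inE (negPf xa) (negPf xb) (negPf xc) (negPf xd).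
rewrite sU edges6U4 // K4_count // eT0' edges6U1 // big_setU1 //=.
rewrite (wsumU1 (link4C a b c d) (link4xx a b c d)) //.
have /andP[_ /eqP->] := K; rewrite [wdeg _ e T]/wdeg /pairs5 [in RHS]big_split /=.
rewrite (_ : \sum_(y in T) link4 a b c d e y =
  \sum_(z in T) (lk a e z + lk b e z + lk c e z + lk d e z)) //.
by move: (edges6 T) (wsum _ _) (wsum _ _) (\sum_(_ in T) _) (\sum_(_ in T) _); clear=> *; lia.
Qed.

Definition pairs6 a b c d e f z :=
  pairs5 a b c d e z + (lk a f z + lk b f z + lk c f z + lk d f z + lk e f z).

Lemma K6_split U a b c d e f : K6 a b c d e f ->
  a \in U -> b \in U -> c \in U -> d \in U -> e \in U -> f \in U ->
  exists T, [/\ #|U| = #|T| + 6, T \subset U &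
    edges6 U = edges6 T + 3 * (wsum (link4 a b c d) T + wsum (lk e) T + wsum (lk f) T)
      + 6 * (\sum_(z in T) pairs6 a b c d e f z) + 120].
Proof.
case/andP => K /eqP p10 aU bU cU dU eU fU.
have [T0 [cT sT memT eN]] := K5_split K aU bU cU dU eU.
have /and5P[abf _ _ _ /and5P[_ cdf aef _ _]] := pairs5_all p10.
have fT0 : f \in T0.
  case/h_neq: abf => _ af bf; case/h_neq: cdf => _ cf df; case/h_neq: aef => _ _ ef.
  by apply: memT; rewrite // !inE ![f == _]eq_sym (negPf af) (negPf bf) (negPf cf) (negPf df).
have [T [eT0 fT cT0 _]] := split_set fT0.
exists T; split; first by rewrite cT cT0; clear; lia.
  by apply: subset_trans sT; rewrite eT0 subsetUr.
rewrite eN eT0 edges6U1 // big_setU1 //= p10 wsum_lkU1 //.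
rewrite (wsumU1 (link4C a b c d) (link4xx a b c d)) // [wdeg (link4 a b c d) f T]/wdeg.
rewrite /pairs6 [in RHS]big_split /=.
have -> : \sum_(z in T) (lk a f z + lk b f z + lk c f z + lk d f z + lk e f z) =
    \sum_(z in T) link4 a b c d f z + wdeg (lk e) f T.
  rewrite /wdeg -big_split; apply: eq_bigr => z _ /=; rewrite /link4.
  by rewrite !(lkC12 _ f).
by move: (edges6 T) (wsum _ _) (wsum _ _) (wsum _ _) (wdeg _ _ _) (\sum_(_ in T) _) (\sum_(_ in T) _);
  clear=> *; lia.
Qed.

(** The clique has 20 edges, and together with [z] it spans at most 30. *)
Lemma pairs6_le a b c d e f z : K6 a b c d e f -> pairs6 a b c d e f z <= 10.
Proof.
case/andP => /andP[K /eqP p6] /eqP p10.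
rewrite -(leq_add2l 20); apply: leq_trans (edges7_le a b c d e f z).
rewrite leq_eqVlt; apply/orP; left; apply/eqP; move: (K4_count K) p6 p10.
by rewrite /pairs6 /pairs5 /pairs4 /edges7; move: lk => l; clear; lia.
Qed.

(** The tetrahedra [abcd], [abef] and [cdef] cover each clique vertex twice. *)
Lemma wsum_links6 a b c d e f T : K6 a b c d e f ->
  2 * (wsum (link4 a b c d) T + wsum (lk e) T + wsum (lk f) T) <= 3 * (if #|T| == 3 then 24 else wmax #|T|).
Proof.
case/andP => K p10; have [K0 Kabce _ Kacde _] := K5_K4 K.
have le_max a' b' c' d' : K4 a' b' c' d' ->
    wsum (link4 a' b' c' d') T <= if #|T| == 3 then 24 else wmax #|T|.
  by move=> K'; case: eqP => [/wsum_link4_max3|/eqP /(wsum_link4_max K')//]; exact.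
have /and5P[abf _ _ _ /and5P[_ cdf aef bef /andP[cef def]]] := pairs5_all (eqP p10).
have [/and4P[_ abe _ _] /and4P[_ _ _ cde]] := conj Kabce Kacde.
have Kabef : K4 a b e f by rewrite /K4 abe abf aef.
have Kcdef : K4 c d e f by rewrite /K4 cde cdf cef.
move: (le_max _ _ _ _ K0) (le_max _ _ _ _ Kabef) (le_max _ _ _ _ Kcdef).
rewrite !wsum_link4; move: (if _ then _ else _) (wsum _ _) (wsum _ _) (wsum _ _).
by move: (wsum _ _) (wsum _ _) (wsum _ _); clear=> *; lia.
Qed.

(** The five tetrahedra of the K_5 cover each of its vertices four times. *)
Lemma wsum_links5 a b c d e T : K5 a b c d e ->
  4 * (wsum (link4 a b c d) T + wsum (lk e) T) <= 5 * (if #|T| == 3 then 24 else wmax #|T|).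
Proof.
move=> K; have [K1 K2 K3 K4' K5'] := K5_K4 K.
have le_max a' b' c' d' : K4 a' b' c' d' ->
    wsum (link4 a' b' c' d') T <= if #|T| == 3 then 24 else wmax #|T|.
  by move=> K'; case: eqP => [/wsum_link4_max3|/eqP /(wsum_link4_max K')//]; exact.
move: (le_max _ _ _ _ K1) (le_max _ _ _ _ K2) (le_max _ _ _ _ K3).
move: (le_max _ _ _ _ K4') (le_max _ _ _ _ K5').
rewrite !wsum_link4; move: (if _ then _ else _) (wsum _ _) (wsum _ _) (wsum _ _).
by move: (wsum _ _) (wsum _ _); clear=> *; lia.
Qed.

Lemma edges6_K6_lt U a b c d e f :
  (forall T, #|T| < #|U| -> 7 <= #|T| -> edges6 T <= bmax6 #|T|) ->
  8 <= #|U| -> K6 a b c d e f ->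
  a \in U -> b \in U -> c \in U -> d \in U -> e \in U -> f \in U ->
  edges6 U < bmax6 #|U|.
Proof.
move=> IH U8 K aU bU cU dU eU fU.
have [T [cT sT ->]] := K6_split K aU bU cU dU eU fU.
have W := wsum_links6 T K.
have P : \sum_(z in T) pairs6 a b c d e f z <= 10 * #|T|.
  by apply: sum_le_const => z _; exact: pairs6_le.
have NT : edges6 T <= if 7 <= #|T| then bmax6 #|T| else #|T| * (#|T|.-1 * #|T|.-2).
  by case: ifP => T7; [apply: IH; rewrite // cT; clear; lia|exact: edges6_le].
by rewrite cT; apply: K6_arith W P NT; rewrite -cT.
Qed.

Definition K6_free U := forall a b c d e f,
  a \in U -> b \in U -> c \in U -> d \in U -> e \in U -> f \in U -> ~~ K6 a b c d e f.

Lemma pairs5_le a b c d e z : pairs5 a b c d e z <= 10.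
Proof. by rewrite -[10]/(6 + (1 + 1 + 1 + 1)) !leq_add ?lk_le1 ?pairs4_le. Qed.

Lemma edges6_K6free_6 U : #|U| = 6 -> K6_free U -> edges6 U <= 114.
Proof.
move=> /pick_split[a [U1 [-> u1 /pick_split[b [U2 [eU1 u2]]]]]].
move=> /pick_split[c [U3 [eU2 u3 /pick_split[d [U4 [eU3 u4]]]]]].
move=> /pick_split[e [U5 [eU4 u5 /eqP/cards1P[f eU5]]]]; move: u1 u2 u3 u4 u5.
rewrite eU1 eU2 eU3 eU4 eU5 -(setU0 [set f]) => u1 u2 u3 u4 u5 UK.
have : edges6 (a |: (b |: (c |: (d |: (e |: (f |: set0)))))) =
    6 * (lk a b c + lk a b d + lk a c d + lk b c d + pairs4 a b c d e + pairs5 a b c d e f).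
  have f0 : f \notin set0 by rewrite inE.
  rewrite !edges6U1 // !wsum_lkU1 // !wsum_set0 !wdegU1 // !wdeg_set0 edges6_set0.
  by rewrite /pairs5 /pairs4; move: lk => l; clear; lia.
move=> ->; have := UK a b c d e f; rewrite !inE !eqxx !orbT => /(_ isT isT isT isT isT isT).
rewrite /K6 /K5; move: (pairs4_le a b c d e) (pairs5_le a b c d e f).
move: (pairs4 a b c d e) (pairs5 a b c d e f) => p q; rewrite /K4 /lk.
move: (h a b c) (h a b d) (h a c d) (h b c d); clear; lia.
Qed.

Lemma pairs5_missing a b c d e z : pairs5 a b c d e z <= 9 ->
  exists i j, i < j < 5 /\ ~~ h (nth a [:: a; b; c; d; e] i) (nth a [:: a; b; c; d; e] j) z.
Proof.
rewrite /pairs5 /pairs4 /lk.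
case: (boolP (h a b z)) => [_|]; last by exists 0, 1.
case: (boolP (h a c z)) => [_|]; last by exists 0, 2.
case: (boolP (h a d z)) => [_|]; last by exists 0, 3.
case: (boolP (h b c z)) => [_|]; last by exists 1, 2.
case: (boolP (h b d z)) => [_|]; last by exists 1, 3.
case: (boolP (h c d z)) => [_|]; last by exists 2, 3.
case: (boolP (h a e z)) => [_|]; last by exists 0, 4.
case: (boolP (h b e z)) => [_|]; last by exists 1, 4.
case: (boolP (h c e z)) => [_|]; last by exists 2, 4.
by case: (boolP (h d e z)) => [_|]; last by exists 3, 4.
Qed.

(** Both [y] and [z] miss a pair of the clique, so by [edges7_no_K5] the seven points span at most
    29 edges, ten of them inside the clique. *)
Lemma K5_pair_le a b c d e y z : K5 a b c d e -> pairs5 a b c d e y <= 9 ->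
  pairs5 a b c d e z <= 9 ->
  link4 a b c d y z + lk e y z + pairs5 a b c d e y + pairs5 a b c d e z <= 19.
Proof.
move=> K /pairs5_missing[i [j [ij hy]]] /pairs5_missing[k [l [kl hz]]].
have sub n : n < 5 -> nth a [:: a; b; c; d; e] n = nth a [:: a; b; c; d; e; y; z] n.
  by case: n => [|[|[|[|[|n]]]]].
have := @edges7_no_K5 a b c d e y z i j k l ij kl.
have [/andP[ij' j5] /andP[kl' l5]] := conj ij kl.
rewrite -!sub ?(ltn_trans ij' j5) ?(ltn_trans kl' l5) // => /(_ hy hz).
have [/and4P[abc abd acd bcd] /and4P[_ abe ace bce] /and4P[_ _ ade bde] /and4P[_ _ _ cde] _] := K5_K4 K.
rewrite abc abd acd bcd abe ace bce ade bde cde => /(_ isT).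
case/andP: K => /K4_count K0 /eqP p6 le29.
rewrite -(leq_add2l 10); apply: leq_trans le29; rewrite leq_eqVlt; apply/orP; left; apply/eqP.
move: K0 p6; rewrite /edges7 /pairs5 /pairs4 /link4.
by move: lk => l'; clear; lia.
Qed.

Lemma edges6_K5_lt U a b c d e :
  (forall T, #|T| < #|U| -> 7 <= #|T| -> edges6 T <= bmax6 #|T|) ->
  8 <= #|U| -> K6_free U -> K5 a b c d e ->
  a \in U -> b \in U -> c \in U -> d \in U -> e \in U ->
  edges6 U < bmax6 #|U|.
Proof.
move=> IH U8 UK K aU bU cU dU eU.
have [T [cT sT _ ->]] := K5_split K aU bU cU dU eU.
have W := wsum_links5 T K.
have p9 z : z \in T -> pairs5 a b c d e z <= 9.
  move=> zT; have := UK a b c d e z aU bU cU dU eU (subsetP sT z zT).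
  by rewrite /K6 K /= => p10; rewrite -ltnS ltn_neqAle p10 pairs5_le.
set p := pairs5 a b c d e in p9 *; pose P := \sum_(z in T) p z.
have P_le : wsum (link4 a b c d) T + wsum (lk e) T + 2 * (#|T| * P) <=
    19 * (#|T| * #|T|.-1) + 2 * P.
  rewrite -wsumD; apply: wsum_pairs_le => [y|y z yT zT]; first by rewrite link4xx lkxx.
  by apply: K5_pair_le => //; exact: p9.
have NT : edges6 T <= if 7 <= #|T| then bmax6 #|T| else
    if #|T| == 6 then 114 else #|T| * (#|T|.-1 * #|T|.-2).
  case: ifP => T7; first by apply: IH; rewrite // cT; clear; lia.
  case: eqP => [T6|_]; last exact: edges6_le.
  by apply: edges6_K6free_6 => // a' b' c' d' e' f' *; apply: UK; apply: (subsetP sT).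
by rewrite cT; apply: K5_arith W P_le NT; rewrite -cT.
Qed.

Lemma K5_dec U : (exists a b c d e,
    [/\ a \in U, b \in U, c \in U, d \in U & e \in U /\ K5 a b c d e]) \/ K5_free U.
Proof.
case: (boolP [forall a in U, forall b in U, forall c in U, forall d in U, forall e in U, ~~ K5 a b c d e]).
  move=> /forall_inP H; right=> a b c d e aU bU cU dU eU.
  by move: (H a aU) => /forall_inP/(_ b bU)/forall_inP/(_ c cU)/forall_inP/(_ d dU)/forall_inP/(_ e eU).
rewrite negb_forall_in => /exists_inP[a aU]; rewrite negb_forall_in => /exists_inP[b bU].
rewrite negb_forall_in => /exists_inP[c cU]; rewrite negb_forall_in => /exists_inP[d dU].
rewrite negb_forall_in => /exists_inP[e eU]; rewrite negbK => K.
by left; exists a, b, c, d, e.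
Qed.

Lemma K6_dec U : (exists a b c d e f,
    [/\ a \in U, b \in U, c \in U, d \in U & [/\ e \in U, f \in U & K6 a b c d e f]]) \/ K6_free U.
Proof.
case: (boolP [forall a in U, forall b in U, forall c in U, forall d in U,
    forall e in U, forall f in U, ~~ K6 a b c d e f]).
  move=> /forall_inP H; right=> a b c d e f aU bU cU dU eU fU.
  move: (H a aU) => /forall_inP/(_ b bU)/forall_inP/(_ c cU)/forall_inP/(_ d dU).
  by move=> /forall_inP/(_ e eU)/forall_inP/(_ f fU).
rewrite negb_forall_in => /exists_inP[a aU]; rewrite negb_forall_in => /exists_inP[b bU].
rewrite negb_forall_in => /exists_inP[c cU]; rewrite negb_forall_in => /exists_inP[d dU].
rewrite negb_forall_in => /exists_inP[e eU]; rewrite negb_forall_in => /exists_inP[f fU].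
by rewrite negbK => K; left; exists a, b, c, d, e, f.
Qed.

(** Both claims come from one induction: a K_5 makes the bound strict, but the proof of this uses
    the bound for smaller sets. *)
Lemma edges6_max_K5 U : 7 <= #|U| ->
  edges6 U <= bmax6 #|U| /\ (8 <= #|U| -> edges6 U = bmax6 #|U| -> K5_free U).
Proof.
have [m] := ubnP #|U|; elim: m U => // m IHm U Um U7.
have IH T : #|T| < #|U| -> 7 <= #|T| -> edges6 T <= bmax6 #|T|.
  by move=> TU T7; case: (IHm T) => //; exact: leq_trans TU _.
have [[a [b [c [d [e [aU bU cU dU [eU K]]]]]]]|UK] := K5_dec U; last first.
  by split=> [|//]; apply: edges6_K5free UK; exact: leq_trans U7.
move: U7; rewrite leq_eqVlt => /orP[/eqP cU7|U8].
  by rewrite -cU7; split=> [|//]; exact: edges6_7.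
suff lt : edges6 U < bmax6 #|U| by split=> [|_ eU']; [exact: ltnW|rewrite eU' ltnn in lt].
(* A K_6 is treated first, since removing a K_5 relies on [pairs5] being at most 9 for every outside
   point. *)
have [[a' [b' [c' [d' [e' [f' [? ? ? ? [? ? K']]]]]]]]|UK] := K6_dec U.
  exact: (edges6_K6_lt IH U8 K').
exact: (edges6_K5_lt IH U8 UK K).
Qed.

Lemma edges6_max U : 7 <= #|U| -> edges6 U <= bmax6 #|U|.
Proof. by case/edges6_max_K5. Qed.


(** * The case of equality *)

Section Extremal.
Variable T : {set V}.
Hypothesis T4 : 4 <= #|T|.

(** A tetrahedron at which the estimates for outside pairs and outside points are tight, [T] being
    the set of outside points. *)
Definition frame a b c d :=
  [/\ K4 a b c d, forall z, z \in T -> pairs4 a b c d z = 5 &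
    wsum (link4 a b c d) T = wmax #|T|].

Lemma wsum_ext (f g : V -> V -> nat) : (forall y z, f y z = g y z) -> wsum f T = wsum g T.
Proof. by move=> fg; apply: eq_bigr => y _; apply: eq_bigr => z _. Qed.

(** With [frame23] and [frame34] this gives every reordering of the tetrahedron. *)
Lemma frame12 a b c d : frame a b c d -> frame b a c d.
Proof.
case=> K p W; split=> [|z /p <-|].
- by move: K; rewrite /K4 !(hC12 b a) => /and4P[-> -> -> ->].
- by rewrite /pairs4 !(lkC12 b a); move: lk => l; clear; lia.
- rewrite -W; apply: wsum_ext => y z; rewrite /link4; move: lk => l; clear; lia.
Qed.

Lemma frame23 a b c d : frame a b c d -> frame a c b d.
Proof.
case=> K p W; split=> [|z /p <-|].
- by move: K; rewrite /K4 !(hC12 c b) !(hC23 a c b) => /and4P[-> -> -> ->].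
- by rewrite /pairs4 !(lkC12 c b); move: lk => l; clear; lia.
- rewrite -W; apply: wsum_ext => y z; rewrite /link4; move: lk => l; clear; lia.
Qed.

Lemma frame34 a b c d : frame a b c d -> frame a b d c.
Proof.
case=> K p W; split=> [|z /p <-|].
- by move: K; rewrite /K4 (hC23 a d) (hC23 b d) => /and4P[-> -> -> ->].
- by rewrite /pairs4 !(lkC12 d c); move: lk => l; clear; lia.
- rewrite -W; apply: wsum_ext => y z; rewrite /link4; move: lk => l; clear; lia.
Qed.

(* If the weight were 11, the seven points would span 30 edges, but the missing
   triples [xyz] and [abx] meet in exactly one point. *)
Lemma frame_triple_ab a b c d x y z : frame a b c d -> x \in T -> y \in T -> z \in T ->
  ~~ h x a b -> link4 a b c d x y + link4 a b c d x z + link4 a b c d y z <= 10.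
Proof.
move=> [/K4_count K p _] /p px /p py /p pz xab; rewrite leqNgt; apply/negP => w11.
(* Here 19 counts the four edges of the tetrahedron and five for each of [x], [y], [z]. *)
have e : edges7 x a b y z c d = 19 + (link4 a b c d x y + link4 a b c d x z +
    link4 a b c d y z) + lk x y z.
  move: K px py pz; rewrite /edges7 /pairs4 /link4.
  rewrite ?(lkC _ y c) ?(lkC _ y d) ?(lkC _ z c) ?(lkC _ z d).
  rewrite ?(lkC12 x a) ?(lkC12 x b) ?(lkC12 x c) ?(lkC12 x d).
  rewrite ?(lkC12 y c) ?(lkC12 y d) ?(lkC12 z c) ?(lkC12 z d).
  rewrite ?(lkC _ x b) ?(lkC _ x c) ?(lkC _ x d) ?(lkC _ y d) ?(lkC _ z d).
  move: lk => l; clear; lia.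
have := edges7_le x a b y z c d; rewrite e => le30.
have xyz : h x y z by apply: (edges7_no_meet1 _ xab (a5 := c) (a6 := d)); rewrite e; move: w11; clear; lia.
by move: le30 w11; rewrite /lk xyz; clear; lia.
Qed.

Lemma hrot x y z : h x y z = h y z x.
Proof. by rewrite hC12 hC23. Qed.

Lemma link4_swap12 a b c d y z : link4 b a c d y z = link4 a b c d y z.
Proof. by rewrite /link4; move: lk => l; clear; lia. Qed.

Lemma link4_swap23 a b c d y z : link4 a c b d y z = link4 a b c d y z.
Proof. by rewrite /link4; move: lk => l; clear; lia. Qed.

Lemma link4_swap34 a b c d y z : link4 a b d c y z = link4 a b c d y z.
Proof. by rewrite /link4; move: lk => l; clear; lia. Qed.

(** Exactly one pair of the tetrahedron forms no edge with [x]; reordering brings that pair to the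
    front. *)
Lemma frame_triple a b c d x y z : frame a b c d -> x \in T -> y \in T -> z \in T ->
  link4 a b c d x y + link4 a b c d x z + link4 a b c d y z <= 10.
Proof.
move=> F xT yT zT.
have [ab|] := boolP (h x a b); last exact: frame_triple_ab.
have [ac|] := boolP (h x a c); last first.
  by move/(frame_triple_ab (frame23 F) xT yT zT); rewrite !(link4_swap23 a b c d).
have [bc|] := boolP (h x b c); last first.
  move/(frame_triple_ab (frame23 (frame12 F)) xT yT zT).
  by rewrite !(link4_swap23 b a c d) !(link4_swap12 a b c d).
have [ad|] := boolP (h x a d); last first.
  move/(frame_triple_ab (frame23 (frame34 F)) xT yT zT).
  by rewrite !(link4_swap23 a b d c) !(link4_swap34 a b c d).
have [bd|] := boolP (h x b d); last first.
  move/(frame_triple_ab (frame23 (frame34 (frame12 F))) xT yT zT).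
  by rewrite !(link4_swap23 b a d c) !(link4_swap34 b a c d) !(link4_swap12 a b c d).
have [cd|] := boolP (h x c d); last first.
  move/(frame_triple_ab (frame23 (frame34 (frame12 (frame23 F)))) xT yT zT).
  by rewrite !(link4_swap23 c a d b) !(link4_swap34 c a b d) !(link4_swap12 a c b d) !(link4_swap23 a b c d).
case: F => _ /(_ x xT) + _; rewrite /pairs4 /lk.
by rewrite -!(hrot x) ab ac bc ad bd cd.
Qed.

(** * The weights outside a tight tetrahedron *)

Section Weights.
Variables a b c d : V.
Hypothesis F : frame a b c d.
Let w := link4 a b c d.

Let K : K4 a b c d. Proof. by case: F. Qed.
Let wC : forall y z, w y z = w z y := link4C a b c d.
Let wxx : forall y, w y y = 0 := link4xx a b c d.
Let wle : forall y z, w y z <= 4 := link4_le a b c d.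
Let w4set u v x y : [|| w u v + w x y <= 4, w u x + w v y <= 4, w u y + w v x <= 4 |
  w u v + w x y + (w u x + w v y) + (w u y + w v x) <= 18] := link4_four_set K u v x y.

Lemma frame_not_heavy : ~~ heavy w T.
Proof.
apply/negP => /existsP[x /andP[xT /existsP[y /andP[yT /existsP[z /andP[zT]]]]]].
by case/and4P => _ _ _; rewrite leqNgt ltnS frame_triple.
Qed.

(** Since no triangle exceeds 10, removing the pair costs at most the growth of [wmax]. The total is
    maximal, so both the cost and the remaining weight are maximal too. *)
Lemma weight4_pair u v : u \in T -> v \in T -> w u v = 4 ->
  exists T', [/\ T = u |: (v |: T'), #|T| = #|T'|.+2, T' \subset T,
    forall x, x \in T' -> w u x + w v x = 6 & wsum w T' = wmax #|T'|].
Proof.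
move=> uT vT uv4; have uv : u != v by apply/eqP => e; move: uv4; rewrite e wxx.
have [T' [cT sT eT _ eW]] := wsum_pair wC wxx uT vT uv.
have le6 x : x \in T' -> w u x + w v x <= 6.
  move=> xT'; have := frame_triple F uT vT (subsetP sT x xT').
  by rewrite -/w uv4 -(leq_add2l 4) !addnA.
have sum6 := sum_le_const le6.
have light : wsum w T' <= wmax #|T'|.
  by apply: (wsum_light wC wxx wle (leqnn _)); exact: heavyS sT frame_not_heavy.
have total : 6 * #|T'| <= \sum_(x in T') (w u x + w v x) /\ wmax #|T'| <= wsum w T'.
  have [_ _] := F; rewrite -/w eW uv4 cT; have := wmaxE #|T'|; have := wmaxE #|T'|.+2.
  move: sum6 light; move: #|T'| (wmax #|T'|.+2) (wmax #|T'|) (wsum w T') (\sum_(_ in T') _).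
  by clear=> *; lia.
exists T'; split=> //; first exact: sum_eq_const total.1.
by apply/eqP; rewrite eqn_leq light total.2.
Qed.

Lemma weight4_sum6 u v x : u \in T -> v \in T -> x \in T -> w u v = 4 ->
  x != u -> x != v -> w u x + w v x = 6.
Proof.
move=> uT vT xT uv4 xu xv; have [T' [eT _ _ s6 _]] := weight4_pair uT vT uv4.
by apply: s6; move: xT; rewrite eT !inE (negPf xu) (negPf xv).
Qed.

Lemma wsum_gt3 U : 2 <= #|U| -> wsum w U = wmax #|U| ->
  exists u v, [/\ u \in U, v \in U & w u v = 4].
Proof.
move=> U2 eW; case: (boolP [exists u in U, exists v in U, w u v == 4]).
  by case/exists_inP => u uU /exists_inP[v vU /eqP ?]; exists u, v.
rewrite negb_exists_in => /forall_inP H.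
have le3 x y : x \in U -> y \in U -> w x y <= 3.
  move=> xU yU; move: (H x xU); rewrite negb_exists_in => /forall_inP/(_ y yU).
  by rewrite -ltnS ltn_neqAle => ->; exact: wle.
have := wsum_le wxx le3; rewrite eW /wmax; move: U2; case: #|U| => [|[|m]] //.
by clear; lia.
Qed.

(** Such a [z] forces weights 3 and 3 on all of [T']: a vertex [x] with 4 and 2 would have weight 3
    to [z], and [u], [v], [x], [z] would total 19. A pair of weight 4 inside [T'] then gives, with
    [u] and [v], a total of 20. *)
Lemma weight_not33 u v z : u \in T -> v \in T -> z \in T -> w u v = 4 ->
  w u z = 3 -> w v z <> 3.
Proof.
move=> uT vT zT uv4 uz vz.
have [T' [eT cT sT s6 eW]] := weight4_pair uT vT uv4.
have all3 x : x \in T' -> w u x = 3 /\ w v x = 3.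
  move=> xT'; have xT := subsetP sT _ xT'.
  have [->|zx] := eqVneq x z; first by [].
  have := s6 x xT'; have [ux|ux] := eqVneq (w u x) 4.
    have zu : z != u by apply/eqP => e; move: uz; rewrite e wxx.
    have := weight4_sum6 uT xT zT ux zu; rewrite eq_sym => /(_ zx).
    have := w4set u v x z; rewrite uz vz uv4 ux (wC x z); clear; lia.
  have [vx|vx] := eqVneq (w v x) 4.
    have zv : z != v by apply/eqP => e; move: vz; rewrite e wxx.
    have := weight4_sum6 vT xT zT vx zv; rewrite eq_sym => /(_ zx).
    have := w4set u v x z; rewrite uz vz uv4 vx (wC x z); clear; lia.
  by move: (wle u x) (wle v x) ux vx; rewrite -/w; clear; lia.
have T'2 : 2 <= #|T'| by move: T4; rewrite cT.
have [x [y [xT yT xy]]] := wsum_gt3 T'2 eW.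
have [[ux vx] [uy vy]] := (all3 x xT, all3 y yT).
by have := w4set u v x y; rewrite uv4 xy ux vx uy vy.
Qed.

Lemma weight_bipartition : exists X Y : {set V},
  [/\ T = X :|: Y, [disjoint X & Y],
    {in X & Y, forall x y, w x y = 4},
    {in X &, forall x y, x != y -> w x y = 2} &
    {in Y &, forall x y, x != y -> w x y = 2}].
Proof.
have [u [v [uT vT uv4]]] : exists u v, [/\ u \in T, v \in T & w u v = 4].
  by apply: wsum_gt3; [apply: leq_trans T4|case: F].
have uv : u != v by apply/eqP => e; move: uv4; rewrite e wxx.
(* The class of a vertex is decided by its weight to [v]; thus [u] lies in the first class and [v],
   of weight 0 to itself, in the second. *)
exists [set x in T | w v x == 4], [set x in T | w v x != 4].
have XP x : x \in T -> w v x = 4 -> x != u -> w u x = 2.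
  move=> xT vx xu; have xv : x != v by apply/eqP => e; move: vx; rewrite e wxx.
  by have := weight4_sum6 uT vT xT uv4 xu xv; rewrite vx; clear; lia.
have YP y : y \in T -> w v y != 4 -> y != v -> w u y = 4 /\ w v y = 2.
  move=> yT vy yv; have yu : y != u by apply: contraNneq vy => ->; rewrite wC uv4.
  have := weight4_sum6 uT vT yT uv4 yu yv; have := weight_not33 uT vT yT uv4.
  move: (wle u y) (wle v y) vy; rewrite -/w; clear; lia.
have cross x y : x \in T -> w v x = 4 -> y \in T -> w v y != 4 -> w x y = 4.
  move=> xT vx yT vy; have [->|yv] := eqVneq y v; first by rewrite wC.
  have [uy vy2] := YP y yT vy yv; have [->//|xu] := eqVneq x u.
  have xv : x != v by apply/eqP => e; move: vx; rewrite e wxx.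
  have yx : y != x by apply: contraNneq vy => ->; rewrite vx.
  by have := weight4_sum6 vT xT yT vx yv yx; rewrite vy2; clear; lia.
split.
- by apply/setP => x; rewrite !inE -andb_orr orbN andbT.
- by rewrite -setI_eq0; apply/eqP/setP => x; rewrite !inE; case: (w v x == 4); rewrite ?andbF.
- by move=> x y; rewrite !inE => /andP[xT /eqP vx] /andP[yT vy]; exact: cross.
- move=> x y; rewrite !inE => /andP[xT /eqP vx] /andP[yT /eqP vy] xy.
  have yv : y != v by apply/eqP => e; move: vy; rewrite e wxx.
  by have := weight4_sum6 vT xT yT vx yv; rewrite eq_sym => /(_ xy); rewrite vy; clear; lia.
- move=> x y; rewrite !inE => /andP[xT vx] /andP[yT vy] xy.
  have ux : w u x = 4 by apply: cross => //; rewrite wC.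
  have uy : w u y = 4 by apply: cross => //; rewrite wC.
  have yu : y != u by apply: contraNneq vy => ->; rewrite wC uv4.
  by have := weight4_sum6 uT xT yT ux yu; rewrite eq_sym => /(_ xy); rewrite uy; clear; lia.
Qed.

End Weights.

(** * Balance of the two classes and the colours inside them *)

Lemma link4_all a b c d y z : link4 a b c d y z = 4 ->
  [&& h a y z, h b y z, h c y z & h d y z].
Proof.
by rewrite /link4 /lk; case: (h a y z); case: (h b y z); case: (h c y z); case: (h d y z).
Qed.

(** With n points, the doubled weight of such a bipartition is [3 n^2 - 2 n] minus the squared
    difference of the class sizes, so attaining [wmax] forces a difference of at most 1. *)
Lemma bipartition_balanced a b c d (X Y : {set V}) : frame a b c d ->
  T = X :|: Y -> [disjoint X & Y] ->
  {in X & Y, forall x y, link4 a b c d x y = 4} ->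
  {in X &, forall x y, x != y -> link4 a b c d x y = 2} ->
  {in Y &, forall x y, x != y -> link4 a b c d x y = 2} ->
  #|X| <= #|Y|.+1 /\ #|Y| <= #|X|.+1.
Proof.
case=> _ _ eW eT XY w4 wX wY.
have inner (Z : {set V}) z : {in Z &, forall x y, x != y -> link4 a b c d x y = 2} ->
    z \in Z -> wdeg (link4 a b c d) z Z + 2 = 2 * #|Z|.
  move=> wZ zZ; rewrite /wdeg (big_setD1 z) //= link4xx add0n (eq_bigr (fun=> 2)) => [|y].
    by rewrite sum_nat_const (cardsD1 z Z) zZ mulnC mulnDr addnC.
  by rewrite !inE => /andP[yz yZ]; apply: wZ; rewrite // eq_sym.
have cT : #|T| = #|X| + #|Y| by rewrite eT cardsU disjoint_setI0 // cards0 subn0.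
have sumT (f : V -> nat) : \sum_(x in T) f x = \sum_(x in X) f x + \sum_(x in Y) f x.
  by rewrite eT -bigU //; apply: eq_bigl => x; rewrite !inE.
have : wsum (link4 a b c d) T + 2 * #|T| = \sum_(x in T) (wdeg (link4 a b c d) x T + 2).
  by rewrite big_split /= sum_nat_const mulnC.
rewrite sumT (eq_bigr (fun=> 2 * #|X| + 4 * #|Y|)) => [|x xX]; last first.
  rewrite {1}/wdeg sumT -/(wdeg _ x X) addnAC (inner X) // (eq_bigr (fun=> 4)) => [|y yY].
    by rewrite sum_nat_const (mulnC _ 4).
  by rewrite w4.
rewrite [X in _ = _ + X](eq_bigr (fun=> 2 * #|Y| + 4 * #|X|)) => [|y yY]; last first.
  rewrite {1}/wdeg sumT -/(wdeg _ y Y) -addnA (inner Y) // addnC (eq_bigr (fun=> 4)) => [|x xX].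
    by rewrite sum_nat_const (mulnC _ 4).
  by rewrite link4C w4.
rewrite !sum_nat_const eW cT; have := wmaxE (#|X| + #|Y|).
move: #|X| #|Y| (wmax (#|X| + #|Y|)); clear=> x y W eW e.
split; rewrite leqNgt; apply/negP => lt.
  (* Substituting an explicit excess turns the quadratic contradiction into a comparison of
     coefficients. *)
  by have [t et] : exists t, x = y + 2 + t; [exists (x - y - 2); lia|subst x; lia].
by have [t et] : exists t, y = x + 2 + t; [exists (y - x - 2); lia|subst y; lia].
Qed.

(** The colours inside [X] are [c] and [d], those inside [Y] are [a] and [b]; so [a] and [b] are to
    join [X], and [c] and [d] to join [Y]. *)
Definition colored a b c d (X Y : {set V}) :=
  [/\ frame a b c d, 1 < #|X| /\ 1 < #|Y|, T = X :|: Y,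
    {in X & Y, forall x y, [&& h a x y, h b x y, h c x y & h d x y]} &
    {in X &, forall x x', x != x' -> [&& ~~ h a x x', ~~ h b x x', h c x x' & h d x x']} /\
    {in Y &, forall y y', y != y' -> [&& h a y y', h b y y', ~~ h c y y' & ~~ h d y y']}].

Lemma colored_sym a b c d X Y : colored a b c d X Y -> colored c d a b Y X.
Proof.
case=> F [X2 Y2] eT cr [cX cY]; split=> //.
- exact: (frame23 (frame34 (frame12 (frame23 F)))).
- by rewrite setUC.
- move=> y x yY xX; have /and4P[? ? ? ?] := cr x y xX yY.
  by apply/and4P; split; rewrite hC23.
- split=> x y xS yS xy; [have := cY x y xS yS xy|have := cX x y xS yS xy];
  by case/and4P => -> -> -> ->.
Qed.

(** If [abx] were an edge, excluding four Fano planes would require four different edges between [y]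
    or [y'] and pairs of the tetrahedron to be absent, while each of [y] and [y'] misses only one
    pair. *)
Lemma colored_ab a b c d X Y x : colored a b c d X Y -> x \in X -> ~~ h a b x.
Proof.
case=> -[/and4P[abc abd acd bcd] p5 _] [_ /card_gt1P[y [y' [yY y'Y yy']]]] eT cr [_ cY] xX.
have yT : y \in T by rewrite eT inE yY orbT.
have y'T : y' \in T by rewrite eT inE y'Y orbT.
have /and4P[ay b_y _ _] := cY y y' yY y'Y yy'.
have /and4P[_ _ cxy dxy] := cr x y xX yY.
have /and4P[_ _ cxy' dxy'] := cr x y' xX y'Y.
apply/negP => abx; have bax : h b a x by rewrite hC12.
have O p q s t : h p q x -> h p y y' -> h p s t -> h t x y -> h s x y' ->
    ~~ (h q s y && h q t y').
  move=> pqx pyy' pst txy sxy'; apply/negP => /andP[qsy qty'].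
  apply: (@no_fano p q x y y' s t) => //; first by rewrite hC23.
  - by rewrite hC23.
  - by rewrite -hrot.
  - by rewrite -hrot.
have adc : h a d c by rewrite hC23.
have bdc : h b d c by rewrite hC23.
have O1 := O a b c d abx ay acd dxy cxy'; have O2 := O a b d c abx ay adc cxy dxy'.
have O3 := O b a c d bax b_y bcd dxy cxy'; have O4 := O b a d c bax b_y bdc cxy dxy'.
move: O1 O2 O3 O4 (p5 y yT) (p5 y' y'T); rewrite /pairs4 /lk.
move: (h a b y) (h a c y) (h a d y) (h b c y) (h b d y) (h c d y).
move: (h a b y') (h a c y') (h a d y') (h b c y') (h b d y') (h c d y').
by do 12 (case=> //).
Qed.

Lemma colored_pairs a b c d X Y x : colored a b c d X Y -> x \in X ->
  [&& h a c x, h a d x, h b c x, h b d x & h c d x].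
Proof.
move=> C xX; have := colored_ab C xX; case: C => -[_ p5 _] _ eT _ _.
have xT : x \in T by rewrite eT inE xX.
move: (p5 x xT); rewrite /pairs4 /lk.
by case: (h a b x); case: (h a c x); case: (h a d x); case: (h b c x); case: (h b d x); case: (h c d x).
Qed.

(** For [t] in [Y], the matchings [cd|ta], [ct|da] and [ca|dt] lie in the links of [x], [y] and [z],
    so [no_fano] applies. *)
Lemma colored_side a b c d X Y x y z : colored a b c d X Y ->
  x \in X -> y \in X -> z \in X -> ~~ h x y z.
Proof.
move=> C xX yX zX; apply/negP => xyz.
have [_ [_ /ltnW/card_gt0P[t tY]] _ cr _] := C.
have edge u : u \in X -> [/\ h u c d, h u t a, h u c t, h u d a & h u c a && h u d t].
  move=> uX; have /and5P[acu adu _ _ cdu] := colored_pairs C uX.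
  have /and4P[aut _ cut dut] := cr u t uX tY.
  split; first by rewrite hrot.
  - by rewrite hC23 hC12.
  - by rewrite hC12.
  - by rewrite hC23 hrot.
  - by rewrite (hC23 u c a) (hrot u a c) acu hC12 dut.
have [xcd xta _ _ _] := edge x xX.
have [_ _ yct yda _] := edge y yX.
have [_ _ _ _ /andP[zca zdt]] := edge z zX.
exact: no_fano xyz xcd xta yct yda zca zdt.
Qed.

Lemma colored_mono a b c d X Y x y z : colored a b c d X Y ->
  x \in a |: (b |: X) -> y \in a |: (b |: X) -> z \in a |: (b |: X) -> ~~ h x y z.
Proof.
move=> C; have [_ _ _ _ [cX _]] := C.
have aX u v : u \in X -> v \in X -> h a u v = false.
  move=> uX vX; have [->|uv] := eqVneq u v; first by rewrite hC12 hC23 hxx.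
  by have /and4P[/negPf-> _ _ _] := cX u v uX vX uv.
have bX u v : u \in X -> v \in X -> h b u v = false.
  move=> uX vX; have [->|uv] := eqVneq u v; first by rewrite hC12 hC23 hxx.
  by have /and4P[_ /negPf-> _ _] := cX u v uX vX uv.
have abX u : u \in X -> h a b u = false by move=> uX; apply: negPf (colored_ab C uX).
have hyy u v : h u v v = false by rewrite hC12 hC23 hxx.
have hyx u v : h u v u = false by rewrite hC23 hxx.
have case3 u : u \in a |: (b |: X) -> [\/ u = a, u = b | u \in X].
  by rewrite !inE => /or3P[/eqP->|/eqP->|->]; [constructor 1|constructor 2|constructor 3].
move=> /case3[->|->|xX] /case3[->|->|yX] /case3[->|->|zX];
  rewrite ?hxx ?hyy ?hyx //.
all: first [exact: colored_side C xX yX zX | by rewrite abX | by rewrite aX | by rewrite bX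
  | by rewrite hC12 abX | by rewrite hC12 aX | by rewrite hC12 bX | by rewrite -hrot abX
  | by rewrite -hrot aX | by rewrite -hrot bX | by rewrite hC23 abX | by rewrite hrot abX
  | by rewrite hC12 -hrot abX].
Qed.

Definition bipartite4 a b c d (X Y : {set V}) :=
  [/\ T = X :|: Y, 1 < #|X| /\ 1 < #|Y|,
    {in X & Y, forall x y, link4 a b c d x y = 4},
    {in X &, forall x y, x != y -> link4 a b c d x y = 2} &
    {in Y &, forall x y, x != y -> link4 a b c d x y = 2}].

(** Crossing pairs carry all four colours, so a colour common to a pair inside [X] and a pair inside
    [Y] completes a Fano plane. Both pairs have two colours, hence complementary ones. *)
Lemma bipartite4_color a b c d X Y u u' v v' : frame a b c d -> bipartite4 a b c d X Y ->
  u \in X -> u' \in X -> u != u' -> v \in Y -> v' \in Y -> v != v' ->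
  [&& h a v v' == ~~ h a u u', h b v v' == ~~ h b u u', h c v v' == ~~ h c u u' &
      h d v v' == ~~ h d u u'].
Proof.
case=> /and4P[abc abd acd bcd] _ _ [_ _ w4 wX wY] uX u'X uu' vY v'Y vv'.
have /link4_all/and4P[auv buv cuv duv] := w4 u v uX vY.
have /link4_all/and4P[au'v bu'v cu'v du'v] := w4 u' v u'X vY.
have /link4_all/and4P[auv' buv' cuv' duv'] := w4 u v' uX v'Y.
have /link4_all/and4P[au'v' bu'v' cu'v' du'v'] := w4 u' v' u'X v'Y.
have aN : ~~ (h a u u' && h a v v').
  by apply/negP => /andP[su sv]; exact: no_fano abc su sv buv bu'v' cuv' cu'v.
have bN : ~~ (h b u u' && h b v v').
  apply/negP => /andP[su sv]; apply: no_fano su sv auv au'v' cuv' cu'v.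
  by rewrite hC12.
have cN : ~~ (h c u u' && h c v v').
  apply/negP => /andP[su sv]; apply: no_fano su sv auv au'v' buv' bu'v.
  by rewrite hrot.
have dN : ~~ (h d u u' && h d v v').
  apply/negP => /andP[su sv]; apply: no_fano su sv auv au'v' buv' bu'v.
  by rewrite hrot.
have := wX u u' uX u'X uu'; have := wY v v' vY v'Y vv'; move: aN bN cN dN.
rewrite /link4 /lk; move: (h a u u') (h b u u') (h c u u') (h d u u').
by move: (h a v v') (h b v v') (h c v v') (h d v v'); do 8 (case=> //).
Qed.

(** One pair inside [X] determines the colours of all pairs inside [Y], and any of these determines
    those inside [X]. *)
Lemma bipartite4_colored a b c d X Y x x' : frame a b c d -> bipartite4 a b c d X Y ->
  x \in X -> x' \in X -> x != x' -> ~~ h a x x' -> ~~ h b x x' -> colored a b c d X Y.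
Proof.
move=> F B xX x'X xx' axx' bxx'; have [eT [X2 Y2] w4 wX wY] := B.
have := wX x x' xX x'X xx'; rewrite /link4 /lk (negPf axx') (negPf bxx').
have [cxx'|] := boolP (h c x x'); last by case: (h d x x').
have [dxx' _|] := boolP (h d x x'); last by [].
have colY : {in Y &, forall y y', y != y' -> [&& h a y y', h b y y', ~~ h c y y' & ~~ h d y y']}.
  move=> y y' yY y'Y yy'; have := bipartite4_color F B xX x'X xx' yY y'Y yy'.
  by rewrite (negPf axx') (negPf bxx') cxx' dxx' => /and4P[/eqP-> /eqP-> /eqP-> /eqP->].
split=> //; first by move=> u v uX vY; apply: link4_all; exact: w4.
split=> // u u' uX u'X uu'; case/card_gt1P: Y2 => y [y' [yY y'Y yy']].
have := bipartite4_color F B uX u'X uu' yY y'Y yy'.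
case/and4P: (colY y y' yY y'Y yy') => -> -> /negPf-> /negPf->.
by case: (h a u u'); case: (h b u u'); case: (h c u u'); case: (h d u u').
Qed.

Lemma bipartite4_ext a b c d a' b' c' d' X Y :
  (forall y z, link4 a' b' c' d' y z = link4 a b c d y z) ->
  bipartite4 a b c d X Y -> bipartite4 a' b' c' d' X Y.
Proof.
move=> e [eT XY w4 wX wY]; split=> // x y xS yS; rewrite e; [exact: w4|exact: wX|exact: wY].
Qed.

(** A single pair inside [X] has two colours; the tetrahedron is reordered so that the other two
    come first, which gives six cases. *)
Lemma frame_colored a b c d : frame a b c d -> exists a' b' c' d' X Y,
  [/\ colored a' b' c' d' X Y, [set a; b; c; d] = [set a'; b'; c'; d'],
      #|T| = #|X| + #|Y|, #|X| <= #|Y|.+1 & #|Y| <= #|X|.+1].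
Proof.
move=> F; have [X [Y [eT XY w4 wX wY]]] := weight_bipartition F.
have [leXY leYX] := bipartition_balanced F eT XY w4 wX wY.
have cT : #|T| = #|X| + #|Y| by rewrite eT cardsU disjoint_setI0 // cards0 subn0.
have XY2 : 1 < #|X| /\ 1 < #|Y| by move: T4 leXY leYX; rewrite cT; clear; lia.
have B : bipartite4 a b c d X Y by split.
have /card_gt1P[x [x' [xX x'X xx']]] := XY2.1.
have := wX x x' xX x'X xx'; rewrite /link4 /lk => w2.
have sub a' b' c' d' : frame a' b' c' d' ->
    (forall y z, link4 a' b' c' d' y z = link4 a b c d y z) ->
    [set a; b; c; d] = [set a'; b'; c'; d'] ->
    ~~ h a' x x' -> ~~ h b' x x' -> exists a' b' c' d' X Y,
    [/\ colored a' b' c' d' X Y, [set a; b; c; d] = [set a'; b'; c'; d'],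
      #|T| = #|X| + #|Y|, #|X| <= #|Y|.+1 & #|Y| <= #|X|.+1].
  move=> F' e eS aN bN; exists a', b', c', d', X, Y; split=> //.
  exact: bipartite4_colored F' (bipartite4_ext e B) xX x'X xx' aN bN.
have perm_set a' b' c' d' : (forall y, [|| y == a, y == b, y == c | y == d] =
    [|| y == a', y == b', y == c' | y == d']) -> [set a; b; c; d] = [set a'; b'; c'; d'].
  by move=> e; apply/setP => y; rewrite !inE -!orbA.
have [ha|ha] := boolP (h a x x'); have [hb|hb] := boolP (h b x x');
  have [hc|hc] := boolP (h c x x'); have [hd|hd] := boolP (h d x x');
  move: w2; rewrite ?ha ?hb ?hc ?hd ?(negPf ha) ?(negPf hb) ?(negPf hc) ?(negPf hd) // => _.
- by apply: (sub c d a b) => //; [exact: (frame23 (frame34 (frame12 (frame23 F))))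
    |move=> y z; rewrite /link4; move: lk => l; clear; lia
    |apply: perm_set => y; case: (y == a); case: (y == b); case: (y == c); case: (y == d)].
- by apply: (sub b d a c) => //; [exact: (frame23 (frame34 (frame12 F)))
    |move=> y z; rewrite /link4; move: lk => l; clear; lia
    |apply: perm_set => y; case: (y == a); case: (y == b); case: (y == c); case: (y == d)].
- by apply: (sub b c a d) => //; [exact: (frame23 (frame12 F))
    |move=> y z; rewrite /link4; move: lk => l; clear; lia
    |apply: perm_set => y; case: (y == a); case: (y == b); case: (y == c); case: (y == d)].
- by apply: (sub a d b c) => //; [exact: (frame23 (frame34 F))
    |move=> y z; rewrite /link4; move: lk => l; clear; lia
    |apply: perm_set => y; case: (y == a); case: (y == b); case: (y == c); case: (y == d)].
- by apply: (sub a c b d) => //; [exact: (frame23 F)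
    |move=> y z; rewrite /link4; move: lk => l; clear; lia
    |apply: perm_set => y; case: (y == a); case: (y == b); case: (y == c); case: (y == d)].
- exact: (sub a b c d).
Qed.

End Extremal.

Theorem extremal_bipartite U : 8 <= #|U| -> edges6 U = bmax6 #|U| ->
  exists A B : {set V}, [/\ U = A :|: B, #|A| + #|B| = #|U|,
    #|A| <= #|B|.+1 /\ #|B| <= #|A|.+1,
    (forall x y z, x \in A -> y \in A -> z \in A -> ~~ h x y z) &
    (forall x y z, x \in B -> y \in B -> z \in B -> ~~ h x y z)].
Proof.
move=> U8 eN; have [_ /(_ U8 eN) UK] := edges6_max_K5 (ltnW U8).
have U4 : 4 <= #|U| by apply: leq_trans U8.
case: (K4_dec U) => [|/(edges6_K4free_lt U4)]; last by rewrite eN ltnn.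
case=> a [b [c [d [aU bU cU dU K]]]].
have [T [eU cT sT [aN bN cN dN]]] := K4_split K aU bU cU dU.
have T4 : 4 <= #|T| by move: U8; rewrite cT.
have p5 z : z \in T -> pairs4 a b c d z <= 5.
  by move=> zT; apply: (K5_free_pairs4 UK) => //; exact: (subsetP sT).
have sum5 := sum_le_const p5.
have W : wsum (link4 a b c d) T <= wmax #|T|.
  by apply: wsum_link4_max => //; apply/eqP => e; rewrite e in T4.
have NT := edges6_K5free T4 (K5_freeS sT UK).
(* The estimates add up to exactly the attained total, so each of them is an equality. *)
have [W_ge p_ge] : wmax #|T| <= wsum (link4 a b c d) T /\
    5 * #|T| <= \sum_(z in T) pairs4 a b c d z.
  move: eN sum5 W NT; rewrite cT {1}eU edges6U4 // (K4_count K).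
  rewrite bmax6_step; last by apply: leq_trans T4.
  move: #|T| (bmax6 #|T|) (wmax #|T|) (edges6 T) (wsum _ T) (\sum_(_ in T) _).
  by clear=> *; lia.
have F : frame T a b c d.
  by split=> //; [exact: sum_eq_const p5 p_ge|apply/eqP; rewrite eqn_leq W].
have [a' [b' [c' [d' [X [Y [C eS cXY leXY leYX]]]]]]] := frame_colored T4 F.
have [_ _ eT _ _] := C.
have eUAB : U = (a' |: (b' |: X)) :|: (c' |: (d' |: Y)).
  have -> : U = [set a; b; c; d] :|: T.
    by rewrite eU; apply/setP => y; rewrite !inE -!orbA.
  rewrite eS eT; apply/setP => y; rewrite !inE.
  case: (y == a'); case: (y == b'); case: (y == c'); case: (y == d') => //;
  by case: (y \in X); case: (y \in Y).
(* Upper bounds on the sizes of the two enlarged classes suffice: they add up to [#|U|], and the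
   classes cover [U]. *)
have cA (x y : V) (Z : {set V}) : #|x |: (y |: Z)| <= #|Z| + 2.
  by rewrite !cardsU1; move: (x \notin _) (y \notin _) #|Z|; clear; lia.
have cUAB : #|U| <= #|a' |: (b' |: X)| + #|c' |: (d' |: Y)|.
  by rewrite eUAB cardsU leq_subr.
exists (a' |: (b' |: X)), (c' |: (d' |: Y)); rewrite -eUAB.
have := cA a' b' X; have := cA c' d' Y; move: cUAB leXY leYX; rewrite cT cXY => h1 h2 h3 h4 h5.
split=> //; first by move: h1 h2 h3 h4 h5; clear; lia.
- by move: h1 h2 h3 h4 h5; clear; lia.
- by move=> x y z; exact: colored_mono C.
- by move=> x y z; exact: colored_mono (colored_sym C).
Qed.

End Hypergraph.

(** * Uniform set families *)

Lemma bin3E n : 6 * 'C(n, 3) + 3 * (n * n) = n * n * n + 2 * n.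
Proof.
have bin2E m : 2 * 'C(m, 2) + m = m * m.
  by elim: m => // m IH; rewrite binS bin1; lia.
by elim: n => // n IH; rewrite binS; have := bin2E n; lia.
Qed.

Lemma b_bmax6 n : 2 <= n -> 6 * b n = bmax6 n.
Proof.
rewrite /b; have [k [->|->]] := half_cases n => k2.
  have := bmax6_even k; have := bin3E k.*2; have := bin3E k.
  rewrite doubleK /= uphalf_double; move: (bmax6 _) 'C(_, 3) 'C(_, 3) => B c c'.
  have : k * k <= k * k * k by rewrite -{1}[k * k]muln1 leq_mul2l; case: k k2 => //; rewrite orbT.
  by lia.
have := bmax6_odd k; have := bin3E k.*2.+1; have := bin3E k; have := bin3E k.+1.
rewrite /= uphalf_double doubleK; move: (bmax6 _) 'C(_, 3) 'C(_, 3) 'C(_, 3) => B c c' c''.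
have : k * k <= k * k * k by rewrite -{1}[k * k]muln1 leq_mul2l; case: k k2 => //; rewrite orbT.
have : k <= k * k by rewrite -{1}[k]muln1 leq_mul2l; case: k k2 => //; rewrite orbT.
by lia.
Qed.

Lemma b_formula n : 2 <= n -> 2 * b n = (n - 2) * (n ^ 2 %/ 4).
Proof.
move=> n2; have := b_bmax6 n2; rewrite /bmax6.
suff -> : n ^ 2 %/ 4 = n./2 * uphalf n by move: (b n) ((n - 2) * _); clear; lia.
have [k [->|->]] := half_cases n.
  by rewrite doubleK uphalf_double; rewrite -mul2n expnMn -[2 ^ 2]/4 mulKn // mulnn.
have -> : k.*2.+1 ^ 2 = k * k.+1 * 4 + 1 by rewrite -mulnn; lia.
by rewrite divnMDl // addn0 /= uphalf_double doubleK.
Qed.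

(** * Set families as symmetric ternary relations *)

Section Translate.
Variables (V : finType) (E : {set {set V}}).
Hypothesis E3 : forall e, e \in E -> #|e| = 3.

Definition edge x y z := [set x; y; z] \in E.

Lemma edgeC12 x y z : edge x y z = edge y x z.
Proof. by rewrite /edge (setUC [set x]). Qed.

Lemma edgeC23 x y z : edge x y z = edge x z y.
Proof. by rewrite /edge setUAC. Qed.

Lemma edgexx x z : edge x x z = false.
Proof.
apply/negP => /E3; rewrite setUid => e3; have := cards2 x z.
by rewrite e3; case: (x != z).
Qed.
End Translate.

Lemma card3_set (V : finType) (e : {set V}) : #|e| = 3 ->
  exists x y z, [/\ e = [set x; y; z], x != y, x != z & y != z].
Proof.
move=> e3; have /card_gt2P[x [y [z [[xe ye ze] [xy yz zx]]]]] : 2 < #|e| by rewrite e3.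
exists x, y, z; rewrite eq_sym in zx; split=> //; apply/esym/eqP.
rewrite eqEcard; apply/andP; split.
  by apply/subsetP => t; rewrite !inE => /orP[/orP[]|] /eqP->.
by rewrite e3 -setUA cardsU1 cards2 !inE (negPf xy) (negPf zx) yz.
Qed.

Lemma edges6_single (V : finType) (e : {set V}) : #|e| = 3 ->
  edges6 (fun x y z => [set x; y; z] == e) setT = 6.
Proof.
move=> e3; set h := fun x y z => _; have [p [q [r [ee pq pr qr]]]] := card3_set e3.
have E3 f : f \in [set e] -> #|f| = 3 by rewrite inE => /eqP->.
have h12 x y z : h x y z = h y x z.
  by have := edgeC12 [set e] x y z; rewrite /edge !inE.
have h23 x y z : h x y z = h x z y.
  by have := edgeC23 [set e] x y z; rewrite /edge !inE.
have hxx x z : h x x z = false.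
  by have := edgexx E3 x z; rewrite /edge !inE.
have sub (F : V -> nat) : (forall x, x \notin e -> F x = 0) ->
    \sum_(x in [set: V]) F x = \sum_(x in e) F x.
  move=> F0; rewrite (big_setID e) /= setTI [X in _ + X]big1 ?addn0 // => x.
  by rewrite !inE => /andP[xe _]; exact: F0.
have hN x y z : x \notin e -> h x y z = false.
  by move=> xe; apply: contraNF xe => /eqP <-; rewrite !inE eqxx.
have -> : edges6 h setT = edges6 h e.
  rewrite /edges6 sub => [|x xe]; last first.
    by rewrite /wsum big1 // => y _; rewrite /wdeg big1 // => z _; rewrite /lk hN.
  apply: eq_bigr => x _; rewrite /wsum sub => [|y ye]; last first.
    by rewrite /wdeg big1 // => z _; rewrite /lk h12 hN.
  apply: eq_bigr => y _; rewrite /wdeg sub => [//|z ze].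
  by rewrite /lk h23 h12 hN.
have -> : e = p |: (q |: (r |: set0)) by rewrite ee setU0 -setUA.
have pN : p \notin q |: (r |: set0) by rewrite !inE (negPf pq) (negPf pr).
have qN : q \notin r |: set0 by rewrite !inE (negPf qr).
have rN : r \notin set0 by rewrite inE.
rewrite !(edges6U1 h12 h23 hxx) // !(wsum_lkU1 h12 h23 hxx) // !wsum_set0 !wdegU1 // !wdeg_set0.
by rewrite edges6_set0 /lk /h ee eqxx.
Qed.

(** The relation of [E] is the sum of the relations of its single edges, and each of these
    contributes the 6 orderings of its points. *)
Lemma edges6_card (V : finType) (E : {set {set V}}) : (forall e, e \in E -> #|e| = 3) ->
  edges6 (edge E) setT = 6 * #|E|.
Proof.
move=> E3; rewrite mulnC -sum_nat_const.
rewrite -(eq_bigr _ (fun e eE => edges6_single (E3 e eE))) /edges6 [RHS]exchange_big /=.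
apply: eq_bigr => x _; rewrite /wsum [RHS]exchange_big /=.
apply: eq_bigr => y _; rewrite /wdeg [RHS]exchange_big /=.
apply: eq_bigr => z _; rewrite /lk /edge; case: (boolP ([set x; y; z] \in E)) => xyz.
  rewrite (bigD1 [set x; y; z]) //= eqxx big1 // => e /andP[_].
  by rewrite eq_sym => /negPf->.
rewrite big1 // => e eE; case: eqP => // exyz; by rewrite exyz eE in xyz.
Qed.

Lemma imset_tri (n : nat) (V : finType) (f : 'I_n.+1 -> V) i j k :
  f @: tri n i j k = [set f (inord i); f (inord j); f (inord k)].
Proof. by rewrite /tri !imsetU !imset_set1. Qed.

Lemma fanoP (V : finType) (P : pred {set V}) (f : 'I_7 -> V) :
  let a i := f (inord i) in
  [forall e in fano, P (f @: e)] =
  [&& P [set a 0; a 1; a 2], P [set a 2; a 3; a 4], P [set a 0; a 4; a 5],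
      P [set a 0; a 3; a 6], P [set a 2; a 5; a 6], P [set a 1; a 4; a 6] &
      P [set a 1; a 3; a 5]].
Proof.
apply/forall_inP/idP => [H|].
  by rewrite -!imset_tri !H // !inE eqxx ?orbT.
move=> /and5P[h1 h2 h3 h4 /and3P[h5 h6 h7]] e.
by rewrite !inE -!orbA => /or4P[|||/or4P[]] /eqP->; rewrite imset_tri.
Qed.

(** Any two points of the Fano plane lie on a line and edges have distinct points, so the seven
    points are automatically distinct. *)
Lemma contains_fano_free (n : nat) (E : {set {set 'I_n}}) :
  (forall e, e \in E -> #|e| = 3) -> ~~ contains fano E ->
  forall a0 a1 a2 a3 a4 a5 a6, let h := edge E in
  ~~ [&& h a0 a1 a2, h a2 a3 a4, h a0 a4 a5, h a0 a3 a6, h a2 a5 a6, h a1 a4 a6 & h a1 a3 a5].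
Proof.
move=> E3 + a0 a1 a2 a3 a4 a5 a6 /=; apply: contra => H.
have neq x y z : edge E x y z -> [/\ x != y, x != z & y != z].
  exact: (h_neq (edgeC12 E) (edgeC23 E) (edgexx E3)).
pose s := [:: a0; a1; a2; a3; a4; a5; a6].
have us : uniq s.
  have /and5P[h1 h2 h3 h4 /and3P[h5 h6 h7]] := H.
  have [a01 a02 a12] := neq _ _ _ h1; have [a23 a24 a34] := neq _ _ _ h2.
  have [a04 a05 a45] := neq _ _ _ h3; have [a03 a06 a36] := neq _ _ _ h4.
  have [a25 a26 a56] := neq _ _ _ h5; have [a14 a16 a46] := neq _ _ _ h6.
  have [a13 a15 a35] := neq _ _ _ h7.
  rewrite /= !inE !negb_or a01 a02 a03 a04 a05 a06 a12 a13 a14 a15 a16.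
  by rewrite a23 a24 a25 a26 a34 a35 a36 a45 a46 a56.
apply/existsP; exists [ffun i : 'I_7 => nth a0 s i]; apply/andP; split.
  apply/injectiveP => i j; rewrite !ffunE => /eqP; rewrite nth_uniq //.
  by move/eqP; exact: val_inj.
rewrite (fanoP (mem E)) /= !ffunE !inordK //.
Qed.

(** * Complete bipartite hypergraphs and hypergraphs avoiding a pair *)

Definition crossing (V : finType) (A : {set V}) : {set {set V}} :=
  [set e : {set V} | [&& #|e| == 3, ~~ (e \subset A) & ~~ (e \subset ~: A)]].

Lemma card_crossing (V : finType) (A : {set V}) :
  #|crossing A| = 'C(#|V|, 3) - 'C(#|A|, 3) - 'C(#|V| - #|A|, 3).
Proof.
have -> : crossing A = [set e : {set V} | #|e| == 3]
    :\: [set e : {set V} | (e \subset A) && (#|e| == 3)]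
    :\: [set e : {set V} | (e \subset ~: A) && (#|e| == 3)].
  apply/setP => e; rewrite !inE.
  by case: (#|e| == 3); case: (e \subset A); case: (e \subset ~: A).
rewrite cardsDS; last first.
  apply/subsetP => e; rewrite !inE => /andP[eA /eqP e3]; rewrite e3 eqxx !andbT.
  apply/negP => eA'; have : e \subset A :&: ~: A by rewrite subsetI eA' eA.
  by rewrite setICr subset0 => /eqP e0; rewrite e0 cards0 in e3.
rewrite cardsDS; last by apply/subsetP => e; rewrite !inE => /andP[].
by rewrite card_draws !cards_draws -(cardsC A) addKn.
Qed.

Lemma imset_crossing (V : finType) (s : {perm V}) (A B : {set V}) :
  s @: A = B -> [set s @: e | e : {set V} in crossing A] = crossing B.
Proof.
move=> eB; have cB : #|B| = #|A| by rewrite -eB card_imset //; exact: perm_inj.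
apply/eqP; rewrite eqEcard; apply/andP; split; last first.
  by rewrite card_imset ?card_crossing ?cB //; exact: imset_inj perm_inj.
apply/subsetP => _ /imsetP[e + ->]; rewrite !inE => /and3P[e3 eA eA'].
rewrite card_imset ?e3 /=; last exact: perm_inj.
apply/andP; split.
  apply: contra eA => seB; apply/subsetP => x xe.
  have : s x \in B by apply: (subsetP seB); exact: imset_f.
  by rewrite -eB mem_imset //; exact: perm_inj.
apply: contra eA' => seB; apply/subsetP => x xe; rewrite inE.
have : s x \in ~: B by apply: (subsetP seB); exact: imset_f.
by rewrite inE -eB mem_imset //; exact: perm_inj.
Qed.

Lemma perm_imset (V : finType) (A B : {set V}) : #|A| = #|B| ->
  exists s : {perm V}, s @: A = B.
Proof.
(* The permutation matches the enumeration of [A] followed by its complement with that of [B]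
   followed by its complement. *)
move=> cAB; pose L (C : {set V}) := enum C ++ enum (~: C).
have uL C : uniq (L C).
  rewrite cat_uniq !enum_uniq andbT /=; apply/hasPn => x; rewrite mem_enum inE => xC.
  by rewrite /= mem_enum.
have memL C x : x \in L C by rewrite mem_cat !mem_enum inE orbN.
have sL C : size (L C) = #|V| by rewrite size_cat -!cardE cardsC.
have f_inj : injective (fun x => nth x (L B) (index x (L A))).
  move=> x y e; have lt z : index z (L A) < size (L B) by rewrite sL -(sL A) index_mem.
  move: e => /eqP; rewrite (set_nth_default x) // nth_uniq // => /eqP.
  by move/(congr1 (nth x (L A))); rewrite !nth_index.
exists (perm f_inj); apply/eqP; rewrite eqEcard; apply/andP; split; last first.
  by rewrite card_imset ?cAB //; exact: perm_inj.
apply/subsetP => _ /imsetP[x xA ->]; rewrite permE.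
have ix : index x (enum A) < size (enum B).
  by rewrite -cardE -cAB cardE index_mem mem_enum.
rewrite /L index_cat mem_enum xA nth_cat ix.
by have := mem_nth x ix; rewrite mem_enum.
Qed.

Lemma card_low n k : k <= n -> #|[set i : 'I_n | i < k]| = k.
Proof.
move=> kn; rewrite -sum1_card big_mkcond /=.
rewrite (eq_bigr (fun i : 'I_n => if (i : nat) < k then 1 else 0)) => [|i _]; last by rewrite inE.
rewrite -(big_mkord xpredT (fun i => if i < k then 1 else 0)).
rewrite -big_mkcond /= -(big_nat_widen 0 k n xpredT) //.
by rewrite sum_nat_const_nat subn0 muln1.
Qed.

Lemma Bn_crossing n : Bn n = crossing [set i : 'I_n | i < n./2].
Proof.
apply/setP => e; rewrite !inE -andbA; congr (_ && _); rewrite andbC.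
congr (_ && _).
  apply/exists_inP/subsetPn => [[x xe lt]|[x xe]].
    by exists x; rewrite // inE -leqNgt.
  by rewrite inE -leqNgt => lt; exists x.
apply/exists_inP/subsetPn => [[x xe lt]|[x xe]].
  by exists x; rewrite // !inE negbK.
by rewrite !inE negbK => lt; exists x.
Qed.

Lemma card_Bn n : #|Bn n| = b n.
Proof.
rewrite Bn_crossing card_crossing card_ord card_low; last by rewrite -[leqRHS]odd_double_half; lia.
by rewrite /b; congr (_ - 'C(_, _)); have [k [->|->]] := half_cases n; rewrite /= ?doubleK ?uphalf_double; lia.
Qed.

Lemma containsP n (E : {set {set 'I_n}}) : contains fano E -> exists f : 'I_7 -> 'I_n,
  injective f /\ let a i := f (inord i) in
  [&& [set a 0; a 1; a 2] \in E, [set a 2; a 3; a 4] \in E, [set a 0; a 4; a 5] \in E,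
      [set a 0; a 3; a 6] \in E, [set a 2; a 5; a 6] \in E, [set a 1; a 4; a 6] \in E &
      [set a 1; a 3; a 5] \in E].
Proof.
case/existsP => f /andP[/injectiveP f_inj fE]; exists f; split=> //=.
by rewrite -(fanoP (mem E)).
Qed.

(** The Fano plane has no 2-colouring without a monochromatic line; all colourings of its points are
    checked. *)
Lemma crossing_fano_free n (A : {set 'I_n}) : ~~ contains fano (crossing A).
Proof.
apply/negP => /containsP[f [_]].
have cr x y z : [set x; y; z] \in crossing A ->
    ~~ [&& x \in A, y \in A & z \in A] && ~~ [&& x \notin A, y \notin A & z \notin A].
  rewrite !inE => /and3P[_ sA sA']; apply/andP; split.
    apply: contra sA => /and3P[xA yA zA]; apply/subsetP => t.
    by rewrite !inE => /orP[/orP[]|] /eqP->.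
  apply: contra sA' => /and3P[xA yA zA]; apply/subsetP => t.
  by rewrite !inE => /orP[/orP[]|] /eqP->.
move=> /=; case/and5P => /cr h1 /cr h2 /cr h3 /cr h4 /and3P[/cr h5 /cr h6 /cr h7].
move: h1 h2 h3 h4 h5 h6 h7.
case: (f (inord 0) \in A); case: (f (inord 1) \in A); case: (f (inord 2) \in A);
case: (f (inord 3) \in A); case: (f (inord 4) \in A); case: (f (inord 5) \in A);
by case: (f (inord 6) \in A).
Qed.

Definition pair_avoiding (V : finType) (i j : V) : {set {set V}} :=
  [set e : {set V} | (#|e| == 3) && ~~ ((i \in e) && (j \in e))].

Lemma card_pair_avoiding (V : finType) (i j : V) : i != j ->
  #|pair_avoiding i j| = 'C(#|V|, 3) - (#|V| - 2).
Proof.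
move=> ij; pose K := [set [set i; j; x] | x in ~: [set i; j]].
have cK : #|K| = #|V| - 2.
  rewrite card_in_imset => [|x y]; first by rewrite -(cardsC [set i; j]) cards2 ij addKn.
  rewrite !inE !negb_or => /andP[xi xj] _ /setP/(_ x).
  by rewrite !inE eqxx (negPf xi) (negPf xj) /= => /esym/eqP.
have -> : pair_avoiding i j = [set e : {set V} | #|e| == 3] :\: K.
  apply/setP => e; rewrite !inE andbC; case: (boolP (#|e| == 3)) => e3; rewrite ?andbF // !andbT.
  congr (~~ _); apply/andP/imsetP => [[ie je]|[x]].
    have : 0 < #|e :\: [set i; j]|.
      rewrite cardsDS; first by rewrite (eqP e3) cards2 ij.
      by apply/subsetP => t; rewrite !inE => /orP[] /eqP->.
    case/card_gt0P => x; rewrite !inE negb_or => /andP[/andP[xi xj] xe].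
    exists x; first by rewrite !inE negb_or xi.
    apply/esym/eqP; rewrite eqEcard; apply/andP; split.
      by apply/subsetP => t; rewrite !inE => /orP[/orP[]|] /eqP->.
    by rewrite (eqP e3) setUC cardsU1 cards2 ij !inE negb_or xi xj.
  by move=> _ ->; rewrite !inE !eqxx ?orbT.
rewrite cardsDS ?cK ?card_draws //; apply/subsetP => _ /imsetP[x + ->].
rewrite !inE negb_or => /andP[xi xj].
by rewrite setUC cardsU1 cards2 ij !inE negb_or xi xj.
Qed.

Lemma imset_pair_avoiding (V : finType) (s : {perm V}) (i j : V) : i != j ->
  [set s @: e | e : {set V} in pair_avoiding i j] = pair_avoiding (s i) (s j).
Proof.
move=> ij; have sij : s i != s j by rewrite (inj_eq perm_inj).
apply/eqP; rewrite eqEcard; apply/andP; split; last first.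
  by rewrite card_imset ?card_pair_avoiding //; exact: imset_inj perm_inj.
apply/subsetP => _ /imsetP[e + ->]; rewrite !inE !(mem_imset _ _ perm_inj).
by rewrite card_imset //; exact: perm_inj.
Qed.

(** On seven vertices a copy of the plane uses both [i] and [j], and the line through them would be
    an edge. *)
Lemma pair_avoiding_fano_free (i j : 'I_7) : i != j -> ~~ contains fano (pair_avoiding i j).
Proof.
move=> ij; apply/negP => /containsP[f [f_inj]] /=; set a := fun k => f (inord k).
have [g _ gK] : bijective f by exact: injF_bij.
have exa x : exists2 k, k < 7 & x = a k by exists (g x); rewrite // /a inord_val gK.
have [k k7 ei] := exa i; have [l l7 ej] := exa j.
have kl : k != l by apply: contraNneq ij => e; rewrite ei ej e.
have memL m x y z : m \in [:: x; y; z] -> a m \in [set a x; a y; a z].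
  by rewrite !inE => /or3P[] /eqP->; rewrite eqxx ?orbT.
have line x y z : [set a x; a y; a z] \in pair_avoiding i j ->
    ~~ ((k \in [:: x; y; z]) && (l \in [:: x; y; z])).
  rewrite inE ei ej => /andP[_]; apply: contra => /andP[/memL-> /memL->] //.
case/and5P => /line h1 /line h2 /line h3 /line h4 /and3P[/line h5 /line h6 /line h7].
move: k7 l7 kl h1 h2 h3 h4 h5 h6 h7; clear.
by case: k => [|[|[|[|[|[|[|k]]]]]]] //; case: l => [|[|[|[|[|[|[|l]]]]]]].
Qed.

Lemma iso_crossing n (A : {set 'I_n}) : #|A| = n./2 -> iso (crossing A) (Bn n).
Proof.
move=> cA; rewrite Bn_crossing; have [|s sA] := @perm_imset _ A [set i : 'I_n | i < n./2].
  by rewrite cA card_low // -[leqRHS]odd_double_half; lia.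
by exists s; exact: imset_crossing.
Qed.

Lemma iso_pair_avoiding (i j : 'I_7) : i != j -> iso (pair_avoiding i j) J7.
Proof.
(* First [i] is moved to 0, then the image of [j] to 1; the second transposition fixes 0. *)
move=> ij; pose s1 := tperm i (inord 0); pose s2 := tperm (s1 j) (inord 1).
have s1j : s1 j != inord 0 by rewrite -(tpermL i (inord 0)) (inj_eq perm_inj) eq_sym.
have n01 : (inord 1 : 'I_7) != inord 0 by rewrite -val_eqE /= !inordK.
exists (s1 * s2)%g; rewrite imset_pair_avoiding // !permM tpermL [s2 (s1 j)]tpermL.
by rewrite tpermD.
Qed.

Lemma crossingC (V : finType) (A : {set V}) : crossing (~: A) = crossing A.
Proof.
by apply/setP => e; rewrite !inE setCK andbA andbAC -andbA.
Qed.

(** * The upper bound, and uniqueness from eight vertices on *)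

Section Extremal.
Variables (n : nat) (E : {set {set 'I_n}}).
Hypothesis E3 : forall e, e \in E -> #|e| = 3.
Hypothesis fanoE : ~~ contains fano E.

Let hC12 := edgeC12 E.
Let hC23 := edgeC23 E.
Let hxx := edgexx E3.
Let FF := contains_fano_free E3 fanoE.

Lemma fano_free_le : 7 <= n -> #|E| <= b n.
Proof.
move=> n7; rewrite -(leq_pmul2l (isT : 0 < 6)) -(edges6_card E3) b_bmax6; last exact: leq_trans n7.
by have := edges6_max hC12 hC23 hxx FF (U := setT); rewrite cardsT card_ord; exact.
Qed.

Lemma extremal_iso_Bn : 8 <= n -> #|E| = b n -> iso E (Bn n).
Proof.
move=> n8 cE; have [|| A [B [eAB cAB [leAB leBA] A_mono B_mono]]] :=
    @extremal_bipartite _ _ hC12 hC23 hxx FF setT.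
- by rewrite cardsT card_ord.
- by rewrite (edges6_card E3) cE b_bmax6 ?cardsT ?card_ord //; exact: leq_trans n8.
have eB : B = ~: A.
  apply/esym/eqP; rewrite eqEcard; apply/andP; split.
    by apply/subsetP => x; have := in_setT x; rewrite eAB !inE => /orP[->|].
  by rewrite -(leq_add2l #|A|) cAB cardsC cardsT.
have EA : E = crossing A.
  apply/eqP; rewrite eqEcard; apply/andP; split; last first.
    rewrite card_crossing cE /b card_ord; move: cAB leAB leBA; rewrite cardsT card_ord.
    move: #|A| #|B| => p q; have [k [->|->]] := half_cases n; rewrite /= ?doubleK ?uphalf_double.
      move=> c1 c2 c3; have -> : p = k by lia.
      by rewrite -addnn addnK.
    move=> c1 c2 c3; have [->|->] : p = k \/ p = k.+1 by lia.
      by rewrite -addnn -addnS addKn.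
    by rewrite -addnn -addSn addKn subnAC.
  apply/subsetP => e eE; rewrite inE E3 //=.
  have [x [y [z [exyz _ _ _]]]] := card3_set (E3 eE).
  have ne (C : {set 'I_n}) : (forall x y z, x \in C -> y \in C -> z \in C -> ~~ edge E x y z) ->
      ~~ (e \subset C).
    move=> C_mono; apply/negP => /subsetP eC.
    have := C_mono x y z; rewrite /edge -exyz eE.
    by rewrite !eC ?exyz ?inE ?eqxx ?orbT // => /(_ isT isT isT).
  by rewrite (ne _ A_mono) -eB (ne _ B_mono).
(* For odd [n] either class may be the smaller one; [crossingC] exchanges them. *)
have [cA|cB] : #|A| = n./2 \/ #|~: A| = n./2.
  move: cAB leAB leBA; rewrite -eB cardsT card_ord.
  move: #|A| #|B| => p q; have [k [->|->]] := half_cases n; rewrite /= ?doubleK ?uphalf_double; lia.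
- by rewrite EA; exact: iso_crossing.
- by rewrite EA -crossingC; exact: iso_crossing.
Qed.
End Extremal.

(** * The extremal families on seven vertices *)

Lemma mem_sort3 i t : in3 i (sort3 t) = in3 i t.
Proof.
case: t => [[x y] z]; rewrite /sort3 /in3.
case: (x < y); case: (_ < z); rewrite ?orbT //=; try case: (_ < z) => /=;
by case: (i == x); case: (i == y); case: (i == z).
Qed.

Lemma sort3_triples x y z : x < 7 -> y < 7 -> z < 7 -> x != y -> x != z -> y != z ->
  sort3 (x, y, z) \in triples.
Proof.
have : all (fun x => all (fun y => all (fun z =>
    [&& x != y, x != z & y != z] ==> (sort3 (x, y, z) \in triples)) (iota 0 7))
    (iota 0 7)) (iota 0 7) by vm_compute.
move=> H x7 y7 z7 xy xz yz.
have mem7 k : k < 7 -> k \in iota 0 7 by rewrite mem_iota.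
move/allP: H => /(_ x (mem7 x x7))/allP/(_ y (mem7 y y7))/allP/(_ z (mem7 z z7)).
by rewrite xy xz yz.
Qed.

Lemma triples_lt t : t \in triples -> [&& t.1.1 < 7, t.1.2 < 7, t.2 < 7, t.1.1 < t.1.2 & t.1.2 < t.2].
Proof.
have /allP : all (fun t : triple => [&& t.1.1 < 7, t.1.2 < 7, t.2 < 7, t.1.1 < t.1.2 & t.1.2 < t.2]) triples.
  by vm_compute.
exact.
Qed.

Section SevenVertices.
Variable E : {set {set 'I_7}}.
Hypothesis E3 : forall e, e \in E -> #|e| = 3.
Hypothesis fanoE : ~~ contains fano E.
Hypothesis cE : #|E| = b 7.

Let hC12 := edgeC12 E.
Let hC23 := edgeC23 E.
Let hxx := edgexx E3.
Let FF := contains_fano_free E3 fanoE.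

Lemma extremal7 : iso E (Bn 7) \/ iso E J7.
Proof.
have [|a0 [a1 [a2 [a3 [a4 [a5 [a6 [us mem_s eN]]]]]]]] := edges6_edges7 hC12 hC23 hxx (U := setT).
  by rewrite cardsT card_ord.
have eE := edges7_missing (edge E) a0 a1 a2 a3 a4 a5 a6.
set s := [:: a0; a1; a2; a3; a4; a5; a6] in us mem_s eE; set a := nth a0 s in eE.
have b7 : b 7 = 30 by [].
have miss5 : size (missing (edge E) a) <= 5.
  move: eN eE; rewrite (edges6_card E3) cE b7 => /eqP; rewrite (eqn_pmul2l (isT : 0 < 6)).
  by move/eqP <-; move: (size _); clear; lia.
have a_inj k l : k < 7 -> l < 7 -> a k = a l -> k = l.
  by move=> k7 l7 /eqP; rewrite nth_uniq // => /eqP.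
have exa x : exists2 k, k < 7 & x = a k.
  have xs : x \in s by rewrite -mem_s in_setT.
  by exists (index x s); [rewrite (index_mem x s)|rewrite /a nth_index].
pose tset (t : triple) := [set a t.1.1; a t.1.2; a t.2].
have mem_tset k t : in3 k t -> a k \in tset t.
  by rewrite !inE => /or3P[] /eqP->; rewrite eqxx ?orbT.
have tset_mem k t : k < 7 -> t.1.1 < 7 -> t.1.2 < 7 -> t.2 < 7 -> a k \in tset t -> in3 k t.
  move=> k7 t1 t2 t3; rewrite !inE => /orP[/orP[]|] /eqP/a_inj->; rewrite // /in3 eqxx ?orbT //.
(* The list [missing] accounts for all non-edges, so inclusions into [E] can be checked on the
   triples of [C]. *)
have nonedge (e : {set 'I_7}) : #|e| = 3 -> e \notin E -> exists2 t, t \in missing (edge E) a & e = tset t.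
  move=> /card3_set[x [y [z [-> xy xz yz]]]].
  have [[k k7 ex] [l l7 ey] [m m7 ez]] := And3 (exa x) (exa y) (exa z).
  have eS : [set x; y; z] = tset (sort3 (k, l, m)).
    apply/setP => u; have [j j7 ->] := exa u; have mem3 := mem_sort3 j (k, l, m).
    have /triples_lt/and5P[t1 t2 t3 _ _] : sort3 (k, l, m) \in triples.
      by apply: sort3_triples => //; [move: xy|move: xz|move: yz]; apply: contraNneq => q; rewrite ?ex ?ey ?ez q.
    apply/idP/idP => [|/(tset_mem _ _ j7 t1 t2 t3)].
      move=> ja; apply: mem_tset; rewrite mem3.
      by move: ja; rewrite !inE ex ey ez => /orP[/orP[]|] /eqP/a_inj->; rewrite // /in3 eqxx ?orbT.
    by rewrite mem_sort3 /in3 ex ey ez !inE /= => /or3P[] /eqP->; rewrite eqxx ?orbT.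
  move=> xyzE; exists (sort3 (k, l, m)) => //.
  rewrite mem_filter hit_sort3 //; apply/andP; split.
    by rewrite /hit /= -ex -ey -ez.
  by apply: sort3_triples => //; [move: xy|move: xz|move: yz]; apply: contraNneq => q; rewrite ?ex ?ey ?ez q.
have missP t : t \in missing (edge E) a -> [&& t.1.1 < 7, t.1.2 < 7, t.2 < 7, t.1.1 < t.1.2 & t.1.2 < t.2].
  by rewrite mem_filter => /andP[_ /triples_lt].
have [C [chkC CM]] := missing_search hC12 hC23 FF search_pencil_or_split miss5.
case/orP: chkC => [/hasP[[i j] ijP /allP C_ij]|/hasP[t tC /allP C_t]]; [right|left].
- have /andP[i7 /andP[ij j7]] : [&& i < 7, i < j & j < 7].
    case/allpairsPdep: ijP => k [l [+ + [-> ->]]]; rewrite !mem_iota; clear; lia.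
  have aij : a i != a j by apply/eqP => /(a_inj _ _ i7 j7) e; rewrite e ltnn in ij.
  suff -> : E = pair_avoiding (a i) (a j) by exact: iso_pair_avoiding.
  (* One inclusion suffices, as both families have 30 members. *)
  apply/esym/eqP; rewrite eqEcard; apply/andP; split.
    apply/subsetP => e; rewrite inE => /andP[/eqP e3]; apply: contraNT => /(nonedge e e3)[t tM ->].
    by rewrite -CM in tM; have /andP[/mem_tset-> /mem_tset->] := C_ij t tM.
  by rewrite card_pair_avoiding // card_ord cE b7.
- have /and5P[t1 t2 t3 t12 t23] : [&& t.1.1 < 7, t.1.2 < 7, t.2 < 7, t.1.1 < t.1.2 & t.1.2 < t.2].
    by apply: missP; rewrite -CM.
  have ct : #|tset t| = 3.
    rewrite /tset -setUA cardsU1 cards2 !inE negb_or.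
    have neq k l : k < 7 -> l < 7 -> k < l -> a k != a l.
      by move=> k7 l7 kl; apply/eqP => /(a_inj _ _ k7 l7) e; rewrite e ltnn in kl.
    by rewrite !neq // (ltn_trans t12).
  (* The isolated missing triple [t] is the class of size three, and the four others lie inside its
     complement. *)
  suff -> : E = crossing (tset t) by apply: iso_crossing.
  apply/esym/eqP; rewrite eqEcard; apply/andP; split.
    apply/subsetP => e; rewrite inE => /and3P[/eqP e3 eA]; apply: contraNT => /(nonedge e e3)[u uM eu].
    have /and5P[u1 u2 u3 _ _] := missP u uM; rewrite -CM in uM.
    case/orP: (C_t u uM) => [/eqP eut|/and3P[n1 n2 n3]]; first by rewrite eu eut subxx in eA.
    apply/subsetP => x; rewrite eu => xu; rewrite inE; apply/negP; rewrite !inE.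
    case/orP=> [/orP[]|] /eqP ex; move: xu; rewrite ex.
    + by move/(tset_mem _ _ t1 u1 u2 u3); apply/negP.
    + by move/(tset_mem _ _ t2 u1 u2 u3); apply/negP.
    + by move/(tset_mem _ _ t3 u1 u2 u3); apply/negP.
  by rewrite card_crossing card_ord ct cE b7.
Qed.
End SevenVertices.

(** * The Turán number of the Fano plane and its extremal hypergraphs *)

Theorem theorem1p1 :
  (forall n : nat, 7 <= n ->
     ex n fano = b n /\
     ((b n)%:R = (((n - 2)%:R / 2%:R) * (n ^ 2 %/ 4)%:R :> rat))%R)
  /\ (forall n : nat, 7 <= n ->
        uniform3 (Bn n) /\ ~~ contains fano (Bn n) /\ #|Bn n| = b n)
  /\ (forall n : nat, 8 <= n -> forall E : {set {set 'I_n}},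
        uniform3 E -> ~~ contains fano E -> #|E| = b n -> iso E (Bn n))
  /\ (uniform3 J7 /\ ~~ contains fano J7 /\ #|J7| = b 7)
  /\ ~ iso (Bn 7) J7
  /\ (forall E : {set {set 'I_7}},
        uniform3 E -> ~~ contains fano E -> #|E| = b 7 ->
        iso E (Bn 7) \/ iso E J7).
Proof.
have uniP n (E : {set {set 'I_n}}) : uniform3 E -> forall e, e \in E -> #|e| = 3.
  by move=> /forall_inP H e /H/eqP.
have uBn n : uniform3 (Bn n).
  by apply/forall_inP => e; rewrite Bn_crossing inE => /and3P[].
have fBn n : ~~ contains fano (Bn n) by rewrite Bn_crossing crossing_fano_free.
have n01 : (inord 0 : 'I_7) != inord 1 by rewrite -val_eqE /= !inordK.
have uJ : uniform3 J7 by apply/forall_inP => e; rewrite inE => /andP[].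
split; [|split; [|split; [|split; [|split]]]].
- move=> n n7; split; last first.
    have := b_formula (leq_trans (isT : 2 <= 7) n7).
    move/(congr1 (fun k : nat => k%:R%R : rat)); rewrite !natrM => e.
    by rewrite mulrAC -e mulrC mulKf.
  apply/eqP; rewrite eqn_leq; apply/andP; split.
    by apply/bigmax_leqP => E /andP[/uniP uE fE]; exact: fano_free_le.
  by rewrite -card_Bn; apply: (leq_bigmax_cond (F := fun E : {set {set 'I_n}} => #|E|)); rewrite uBn fBn.
- by move=> n n7; rewrite card_Bn.
- by move=> n n8 E /uniP uE fE; exact: extremal_iso_Bn.
- split=> //; split; first exact: pair_avoiding_fano_free.
  by rewrite -[J7]/(pair_avoiding _ _) card_pair_avoiding // card_ord.
(* Both classes of [B_7] contain a non-edge, so [B_7] has two disjoint ones, whereas every non-edge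
   of [J_7] contains the vertex 0. *)
- case=> s sB; pose A : {set 'I_7} := [set i : 'I_7 | i < 7./2].
  have inJ (e : {set 'I_7}) : s @: e \in J7 -> e \in Bn 7.
    by rewrite -sB => /imsetP[e' e'B /(imset_inj perm_inj)->].
  have cA : #|A| = 3 by rewrite card_low.
  have has01 (e : {set 'I_7}) : #|e| = 3 -> e \notin Bn 7 -> inord 0 \in s @: e.
    move=> e3; apply: contraR => e0; apply: inJ.
    by rewrite inE (negPf e0) card_imset ?e3 //; exact: perm_inj.
  have A0 : inord 0 \in s @: A by apply: has01; rewrite // Bn_crossing inE subxx andbF.
  have [B] : exists B, B \in [set e : {set 'I_7} | (e \subset ~: A) && (#|e| == 3)].
    apply/card_gt0P; rewrite cards_draws.
    by have := cardsC A; rewrite cA card_ord => /(@addnI 3 _ 4)->.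
  rewrite inE => /andP[BA /eqP B3].
  have B0 : inord 0 \in s @: B by apply: has01; rewrite // Bn_crossing inE BA !andbF.
  case/imsetP: A0 => x xA ex; case/imsetP: B0 => y yB; rewrite ex => /perm_inj exy.
  by have := subsetP BA y yB; rewrite -exy inE xA.
- by move=> E /uniP uE fE cE; exact: extremal7.
Qed.
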